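(* Consider the stochastic approximation process with expanding projections $(\theta_i,X_i)_{i\ge 0}$ described in the context, and suppose that condition (W) holds with constants $(\xi_i)_{i\ge0}$ and $\alpha_w\in(0,\infty)$. Let $(U_i)_{i\ge1}$ be a sequence of independent random variables uniformly distributed on $[0,1]$, with $U_{i+1}$ independent of $\mathcal{F}_i$ and $X_{i+1}$ for all $i\ge 0$, and assume $\Gamma_i\equiv\gamma_i\mathbb{I}\{U_i\le p_i\}$, where the constant sequences $(\gamma_i)_{i\ge1}\subset(0,1)$ and $(p_i)_{i\ge1}\subset[0,1]$ are defined as $\gamma_i:=c_\gamma i^{-\eta_\gamma}$ and $p_i:=c_p i^{-\eta_p}$ for some $c_\gamma,c_p\in(0,\infty)$ and $\eta_\gamma,\eta_p\in(0,1)$ such that $\eta_\gamma+\eta_p\le1$, $2\eta_\gamma+\eta_p>1$ and $\eta_\gamma+2\eta_p>1$. Suppose that for a measurable $V:\mathsf{X}\to[1,\infty)$: (a) there are constants $c<\infty$, $\beta_H\in[0,1/2]$ and $\alpha_H,\alpha_V\in[0,\infty)$ such that for all $i\ge 0$ and $(\theta,x)\in\mathcal{R}_0\times\mathsf{X}$: $\sup_{\theta'\in\mathcal{R}_i}|H(\theta',x)|\le c\,\xi_i^{\alpha_H}V^{\beta_H}(x)$ and $\mathbb{E}_{\theta,x}[V(X_i)]\le c\,\xi_i^{\alpha_V}V(x)$; (b) the ergodicity condition (G) of the context holds, with constants $\alpha_M,\alpha_\rho\in[0,\infty)$; (c) $$\sum_{i=1}^\infty i^{-\eta_\gamma-2\eta_p}\,\xi_i^{\alpha_w+\alpha_M+\alpha_\rho+\alpha_H+\beta_H\alpha_V}<\infty,\qquad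 \sum_{i=1}^\infty i^{-2\eta_\gamma-\eta_p}\,\xi_i^{2(\alpha_w+\alpha_H+\alpha_M+\alpha_\rho+\beta_H\alpha_V)}<\infty .$$ Then condition (P) stated in the context is satisfied.
   Context: Setting. Let $\Theta\subset\mathbb{R}^d$ and let $(\mathsf{X},\mathcal{B}(\mathsf{X}))$ be a measurable space. Let $\{P_\theta\}_{\theta\in\Theta}$ be a family of Markov transition probabilities on $\mathsf{X}$; for each $\theta\in\hat\Theta$ (defined below) $P_\theta$ admits a unique invariant probability measure $\pi_\theta$. Let $H:\Theta\times\mathsf{X}\to\mathbb{R}^d$ be measurable, $h(\theta):=\int_{\mathsf{X}}H(\theta,x)\,\pi_\theta(\mathrm{d}x)$, $\bar H(\theta,x):=H(\theta,x)-h(\theta)$. $\langle\cdot,\cdot\rangle$ and $|\cdot|$ are the standard inner product and norm on $\mathbb{R}^d$; $a\vee b:=\max\{a,b\}$. For measurable $f:\mathsf{X}\to\mathbb{R}^d$ and $r>0$, $\|f\|_{V^r}:=\sup_x|f(x)|/V^r(x)$. Write $P^k(x,f)=P^kf(x)$. Process. Let $\{\mathcal{R}_i\}_{i\ge0}$ be subsets of $\Theta$ and let $(\Gamma_i)_{i\ge1}$ be nonnegative random variables. For a starting point $(\theta_0,X_0)\equiv(\theta,x)\in\mathcal{R}_0\times\mathsf{X}$ and recursively for $i\ge0$: $X_{i+1}\mid\mathcal{F}_i\sim P_{\theta_i}(X_i,\cdot)$; $\theta_{i+1}^*=\theta_i+\Gamma_{i+1}H(\theta_i,X_{i+1})$;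 $\theta_{i+1}=\theta_{i+1}^*\mathbb{I}\{\theta_{i+1}^*\in\mathcal{R}_{i+1}\}+\theta_{i+1}^{\mathrm{proj}}\mathbb{I}\{\theta_{i+1}^*\notin\mathcal{R}_{i+1}\}$, where $\mathcal{F}_i=\sigma(\theta_0,X_0,\theta_1,X_1,\Gamma_1,\ldots,\theta_i,X_i,\Gamma_i)$ and $\theta_{i+1}^{\mathrm{proj}}$ is a $\sigma(\mathcal{F}_i,X_{i+1},\theta_{i+1}^* )$-measurable random variable taking values in $\mathcal{R}_{i+1}$. $\mathbb{P}_{\theta,x}$, $\mathbb{E}_{\theta,x}$ denote the law of the process started at $(\theta,x)$ and the expectation; $\mathbb{E}:=\mathbb{E}_{\theta,x}$ whenever the expectation does not depend on $(\theta,x)$. $\mathcal{W}_M:=\{\theta\in\Theta:w(\theta)\le M\}$. Condition (W). There exists a twice continuously differentiable $w:\Theta\to[0,\infty)$ such that (i) $\sup_{\theta\in\Theta}\sup_{|\theta_0|=1}|\mathrm{Hess}_w(\theta)\theta_0|<\infty$, where $\mathrm{Hess}_w$ is the Hessian matrix of $w$; (ii) $\mathcal{R}_i\subset\mathcal{R}_{i+1}$ for all $i\ge0$, and $\hat\Theta:=\bigcup_{i=0}^\infty\mathcal{R}_i\subset\Theta$; (iii) there is $M_0>0$ such that $\langle\nabla w(\theta),h(\theta)\rangle\le0$ for any $\theta\in\mathcal{W}_{M_0}^c\cap\hat\Theta$; (iv) for all $i\ge1$, whenever $\theta_i^*\notin\mathcal{R}_i$: $\theta_i^{\mathrm{proj}}\in\mathcal{R}_i$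 and $w(\theta_i^{\mathrm{proj}})\le w(\theta_i^* )$, $\mathbb{P}_{\theta,x}$-a.s.; (v) there are constants $\alpha_w,c\in[0,\infty)$ and a non-decreasing sequence $\xi_i\in[1,\infty)$ with $\sup_{\theta\in\mathcal{R}_i}|\nabla w(\theta)|\le c\,\xi_i^{\alpha_w}$ for all $i\ge0$. Condition (G). For any $r\in(0,1]$ and $\theta\in\hat\Theta$ there exist $M_{\theta,r}\in[0,\infty)$ and $\rho_{\theta,r}\in(0,1)$ such that for any $f$ with $\|f\|_{V^r}<\infty$, $|P_\theta^k(x,f)-\pi_\theta(f)|\le V^r(x)\|f\|_{V^r}M_{\theta,r}\rho_{\theta,r}^k$ for all $k\ge0$, $x\in\mathsf{X}$; and these satisfy, for all $i\ge 0$, $\sup_{\theta\in\mathcal{R}_i}M_{\theta,r}\le c_r\xi_i^{\alpha_M}$ and $\sup_{\theta\in\mathcal{R}_i}(1-\rho_{\theta,r})^{-1}\le c_r\xi_i^{\alpha_\rho}$ for some constants $\alpha_M,\alpha_\rho\in[0,\infty)$ and a constant $c_r\in[0,\infty)$ depending only on $r$. Condition (P). Condition (W) holds with $(\xi_i)_{i\ge0}$ and $\alpha_w\in(0,\infty)$. For all $\theta\in\hat\Theta$ a solution $g_\theta:\mathsf{X}\to\mathbb{R}^d$ to the Poisson equation $g_\theta(x)-P_\theta g_\theta(x)\equiv\bar H(\theta,x)$ exists and for all $i\ge0$ the step size $\Gamma_{i+1}$ is independent of $\mathcal{F}_i$ and $X_{i+1}$. Moreover there exist a measurable $V:\mathsf{X}\to[1,\infty)$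 and constants $c<\infty$, $\beta_H,\beta_g\in[0,1/2]$, $\alpha_g,\alpha_H,\alpha_V\in[0,\infty)$ such that for all $(\theta,x)\in\mathcal{R}_0\times\mathsf{X}$ (and all $i\ge0$ in (i)–(iii)) (i) $\sup_{\theta\in\mathcal{R}_i}|H(\theta,x)|\le c\,\xi_i^{\alpha_H}V^{\beta_H}(x)$; (ii) $\mathbb{E}_{\theta,x}[V(X_i)]\le c\,\xi_i^{\alpha_V}V(x)$; (iii) $\sup_{\theta\in\mathcal{R}_i}[|g_\theta(x)|+|P_\theta g_\theta(x)|]\le c\,\xi_i^{\alpha_g}V^{\beta_g}(x)$; (iv) $\sum_{i\ge1}\mathbb{E}[\Gamma_{i+1}]\xi_i^{\alpha_w}\mathbb{E}_{\theta,x}[|P_{\theta_i}g_{\theta_i}(X_i)-P_{\theta_{i-1}}g_{\theta_{i-1}}(X_i)|]<\infty$; (v) $\sum_{i\ge1}\mathbb{E}[\Gamma_i^2]\xi_i^{2\alpha_w+2((\alpha_H+\beta_H\alpha_V)\vee(\alpha_g+\beta_g\alpha_V))}<\infty$; (vi) $\sum_{i\ge1}\mathbb{E}[\Gamma_{i+1}\Gamma_i]\xi_i^{\alpha_H+\alpha_g+(\beta_H+\beta_g)\alpha_V}<\infty$; (vii) $\sum_{i\ge1}|\mathbb{E}[\Gamma_{i+1}-\Gamma_i]|\xi_i^{\alpha_w+\alpha_g+\beta_g\alpha_V}<\infty$. *)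

(* Defs.v *)
From HB Require Import structures.
From mathcomp Require Import all_boot all_order all_algebra.
From mathcomp Require Import all_classical all_reals all_analysis.
From mathcomp Require Import measurable_realfun.

Set Implicit Arguments.
Unset Strict Implicit.
Unset Printing Implicit Defensive.
Import Order.TTheory GRing.Theory Num.Theory.
Import numFieldNormedType.Exports.

Local Open Scope classical_set_scope.
Local Open Scope ring_scope.

(* The product sigma-algebra on matrices, generated by the entries; on
   'rV[R]_d it is the Borel sigma-algebra of R^d. *)
Definition mx_display : measure_display -> measure_display.
Proof. exact. Qed.

Section measurable_matrix.
Context {R : realType} (m n : nat).

Definition mx_cylinders : set (set 'M[R]_(m, n)) :=
  [set A | exists i j, exists2 B : set R,
     measurable B & A = (fun M : 'M[R]_(m, n) => M i j) @^-1` B].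

Let mx0 : <<s mx_cylinders >> set0.
Proof. exact: sigma_algebra0. Qed.

Let mxC A : <<s mx_cylinders >> A -> <<s mx_cylinders >> (~` A).
Proof. exact: sigma_algebraC. Qed.

Let mxU (F : (set 'M[R]_(m, n))^nat) :
  (forall i, <<s mx_cylinders >> (F i)) ->
  <<s mx_cylinders >> (\bigcup_i F i).
Proof. exact: sigma_algebra_bigcup. Qed.

HB.instance Definition _ := @isMeasurable.Build (mx_display R.-ocitv)
  'M[R]_(m, n) <<s mx_cylinders >> mx0 mxC mxU.
End measurable_matrix.

(* Measurability of f on D for the trace sigma-algebra of D.  The library's
   [measurable_fun D f] is vacuous when D is not measurable, and here Theta is
   an arbitrary subset of R^d. *)
Definition trace_measurable d1 d2 (T1 : measurableType d1)
    (T2 : measurableType d2) (D : set T1) (f : T1 -> T2) : Prop :=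
  preimage_set_system D f measurable `<=` strace measurable D.

Section euclidean.
Context {R : realType} {d : nat}.
Implicit Types (u v t : 'rV[R]_d) (w : 'rV[R]_d -> R).

(* The library norm on 'rV[R]_d is the sup norm. *)
Definition enorm v : R := Num.sqrt (\sum_j v ord0 j ^+ 2).

Definition dot u v : R := \sum_j u ord0 j * v ord0 j.

Definition grad w t : 'rV[R]_d := \row_j 'D_(delta_mx ord0 j) w t.

(* Row convention: the directional derivative of [grad w] along u is
   [u *m hess w t]. *)
Definition hess w : 'rV[R]_d -> 'M[R]_d := jacobian (grad w).

(* C^2 on an arbitrary subset D: restriction of a C^2 function on an open
   neighbourhood of D; for D open this is the usual notion. *)
Definition C2_on (D : set 'rV[R]_d) w : Prop :=
  exists O : set 'rV[R]_d, [/\ open O, D `<=` O &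
    forall t, O t ->
      [/\ differentiable w t, differentiable (grad w) t &
          {for t, continuous (hess w)}]].

End euclidean.

Section vector_integral.
Context {R : realType} {d : nat} {dX : measure_display}
  {X : measurableType dX}.
Implicit Types (mu : {measure set X -> \bar R}) (f : X -> 'rV[R]_d).

Definition vintegrable mu f : Prop :=
  forall j, mu.-integrable [set: X] (fun x => (f x ord0 j)%:E).

Definition vintegral mu f : 'rV[R]_d := \row_j (\int[mu]_x (f x ord0 j)).

Definition Vnorm (V : X -> R) (r : R) f : \bar R :=
  ereal_sup [set (enorm (f x) / V x `^ r)%:E | x in [set: X]].

End vector_integral.

Section kernels.
Context {R : realType} {dX : measure_display} {X : measurableType dX}.

Fixpoint kpow (Q : R.-spker X ~> X) (k : nat) : R.-spker X ~> X :=
  if k is k'.+1 then mkcomp_noparam Q (kpow Q k')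
  else kdirac (@measurable_id _ X [set: X]).

Definition invariant_prob (Q : R.-pker X ~> X) (mu : probability X R) : Prop :=
  forall A, measurable A -> (\int[mu]_x Q x A)%E = mu A.

End kernels.

Section independence.
Context {R : realType} {dW : measure_display} {W : measurableType dW}.
Implicit Types (Pr : probability W R) (G : set (set W)).

Definition indep_of Pr G (Y : W -> R) : Prop :=
  forall (A : set W) (B : set R), G A -> measurable B ->
    Pr (A `&` Y @^-1` B) = (Pr A * Pr (Y @^-1` B))%E.

(* Mutual independence of the sequence U_1, U_2, ... *)
Definition mutually_indep Pr (U : nat -> W -> R) : Prop :=
  forall (s : seq nat) (B : nat -> set R), uniq s -> 0%N \notin s ->
    (forall j, measurable (B j)) ->
    Pr (\bigcap_(j in [set` s]) (U j @^-1` B j)) =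
    (\prod_(j <- s) fine (Pr (U j @^-1` B j)))%:E.

End independence.

(* The process started from one point: its own probability space, and
   theta_i, theta_i^proj, X_i, Gamma_i (theta_0^proj and Gamma_0 are unused). *)
Record sa_data (R : realType) (d : nat) (dX : measure_display)
    (X : measurableType dX) := SaData {
  sa_disp : measure_display;
  sa_space : measurableType sa_disp;
  law : probability sa_space R;
  theta : nat -> {mfun sa_space >-> 'rV[R]_d};
  theta_proj : nat -> sa_space -> 'rV[R]_d;
  state : nat -> {mfun sa_space >-> X};
  step : nat -> {mfun sa_space >-> R} }.
Arguments law {R d dX X} _.
Arguments theta {R d dX X} _ _.
Arguments theta_proj {R d dX X} _ _ _.
Arguments state {R d dX X} _ _.
Arguments step {R d dX X} _ _.

Section process.
Context {R : realType} {d : nat} {dX : measure_display}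
  {X : measurableType dX}.
Implicit Types (Theta : set 'rV[R]_d) (P : 'rV[R]_d -> R.-pker X ~> X)
  (H : 'rV[R]_d -> X -> 'rV[R]_d) (Rs : nat -> set 'rV[R]_d)
  (Z : sa_data R d X).

(* theta_i^*, for i >= 1 *)
Definition theta_star H Z (i : nat) (o : sa_space Z) : 'rV[R]_d :=
  theta Z i.-1 o + step Z i o *: H (theta Z i.-1 o) (state Z i o).
Arguments theta_star H Z i o : clear implicits.

Definition sigma_gen (W : Type) d' (T : measurableType d') (Y : W -> T) :
    set (set W) :=
  preimage_set_system [set: W] Y measurable.

(* F_i; there is no Gamma_0 *)
Definition filt Z (i : nat) : set (set (sa_space Z)) :=
  <<s (\bigcup_(j in [set j | (j <= i)%N])
         (sigma_gen (theta Z j) `|` sigma_gen (state Z j))) `|`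
      (\bigcup_(j in [set j | (1 <= j <= i)%N]) sigma_gen (step Z j)) >>.
Arguments filt Z i : clear implicits.

Definition filtX Z (i : nat) : set (set (sa_space Z)) :=
  <<s filt Z i `|` sigma_gen (state Z i.+1) >>.
Arguments filtX Z i : clear implicits.

Definition filtX_star H Z (i : nat) : set (set (sa_space Z)) :=
  <<s filt Z i `|` sigma_gen (state Z i.+1) `|`
      sigma_gen (theta_star H Z i.+1) >>.
Arguments filtX_star H Z i : clear implicits.

Record sa_process_from P H Rs Z (t0 : 'rV[R]_d) (x0 : X) : Prop :=
  SaProcessFrom {
  sa_theta0 : forall o, theta Z 0 o = t0;
  sa_state0 : forall o, state Z 0 o = x0;
  sa_step_ge0 : forall i o, (1 <= i)%N -> 0 <= step Z i o;
  sa_transition : forall i (A : set (sa_space Z)) (B : set X),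
    filt Z i A -> measurable B ->
    law Z (A `&` state Z i.+1 @^-1` B) =
    (\int[law Z]_(o in A) P (theta Z i o) (state Z i o) B)%E;
  sa_theta : forall i o, theta Z i.+1 o =
    if theta_star H Z i.+1 o \in Rs i.+1 then theta_star H Z i.+1 o
    else theta_proj Z i.+1 o;
  sa_proj_in : forall i (o : sa_space Z), Rs i.+1 (theta_proj Z i.+1 o);
  sa_proj_measurable : forall i (B : set 'rV[R]_d), measurable B ->
    filtX_star H Z i (theta_proj Z i.+1 @^-1` B) }.

End process.

Arguments theta_star {R d dX X} H Z i o.
Arguments filt {R d dX X} Z i.
Arguments filtX {R d dX X} Z i.
Arguments filtX_star {R d dX X} H Z i.

Section conditions.
Context {R : realType} {d : nat} {dX : measure_display}
  {X : measurableType dX}.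
Variables (Theta : set 'rV[R]_d) (P : 'rV[R]_d -> R.-pker X ~> X)
  (pi : 'rV[R]_d -> probability X R) (H : 'rV[R]_d -> X -> 'rV[R]_d)
  (Rs : nat -> set 'rV[R]_d) (Z : 'rV[R]_d -> X -> sa_data R d X)
  (xi : nat -> R).

Definition Theta_hat : set 'rV[R]_d := \bigcup_i Rs i.

Definition mean_field (t : 'rV[R]_d) : 'rV[R]_d := vintegral (pi t) (H t).

Definition condW (alpha_w : R) : Prop :=
  exists (w : 'rV[R]_d -> R) (M0 c : R),
  [/\ C2_on Theta w /\ (forall t, Theta t -> 0 <= w t),
      exists C : R, forall t u, Theta t -> enorm u = 1 ->
        enorm (u *m hess w t) <= C,
      (forall i, Rs i `<=` Rs i.+1) /\ Theta_hat `<=` Theta,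
      0 < M0 /\ (forall t, Theta_hat t -> M0 < w t ->
        dot (grad w t) (mean_field t) <= 0) &
  [/\ (* w lives on Theta, so its values are compared only when theta_i^*
         lies in Theta; outside, read w as +oo *)
      forall t x, Rs 0%N t -> forall i, (1 <= i)%N ->
        {ae law (Z t x), forall o,
          ~ Rs i (theta_star H (Z t x) i o) ->
          Rs i (theta_proj (Z t x) i o) /\
          (Theta (theta_star H (Z t x) i o) ->
             w (theta_proj (Z t x) i o) <= w (theta_star H (Z t x) i o))},
      0 <= alpha_w, 0 <= c,
      (forall i, 1 <= xi i) /\ (forall i, xi i <= xi i.+1) &
      forall i t, Rs i t -> enorm (grad w t) <= c * xi i `^ alpha_w]].

Definition condG (V : X -> R) (alpha_M alpha_rho : R) : Prop :=
  [/\ 0 <= alpha_M, 0 <= alpha_rho &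
  forall r : R, 0 < r <= 1 ->
  exists (M rho : 'rV[R]_d -> R) (c_r : R),
  [/\ 0 <= c_r,
      forall t, Theta_hat t -> 0 <= M t /\ 0 < rho t < 1,
      forall t, Theta_hat t ->
        forall f : X -> 'rV[R]_d, measurable_fun [set: X] f ->
        (Vnorm V r f < +oo)%E ->
        vintegrable (pi t) f /\
        forall k x, vintegrable (kpow (P t) k x) f /\
          enorm (vintegral (kpow (P t) k x) f - vintegral (pi t) f) <=
          V x `^ r * fine (Vnorm V r f) * M t * rho t ^+ k &
      forall i t, Rs i t ->
        M t <= c_r * xi i `^ alpha_M /\
        (1 - rho t)^-1 <= c_r * xi i `^ alpha_rho]].

Definition poisson_solution (t : 'rV[R]_d) (g : X -> 'rV[R]_d) : Prop :=
  [/\ vintegrable (pi t) (H t),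
      measurable_fun [set: X] g,
      forall x, vintegrable (P t x) g &
      forall x, g x - vintegral (P t x) g = H t x - mean_field t].

(* The expectation does not depend on the starting point, so that it may be
   written E instead of E_{theta,x}. *)
Definition start_free (e : sa_data R d X -> \bar R) : Prop :=
  forall t x t' x', Rs 0%N t -> Rs 0%N t' -> e (Z t x) = e (Z t' x').

Definition condP (alpha_w : R) : Prop :=
  [/\ condW alpha_w, 0 < alpha_w &
  exists g : 'rV[R]_d -> X -> 'rV[R]_d,
  let Pg t x := vintegral (P t x) (g t) in
  [/\ forall t, Theta_hat t -> poisson_solution t (g t),
      forall t x, Rs 0%N t -> forall i,
        indep_of (law (Z t x)) (filtX (Z t x) i) (step (Z t x) i.+1),
      forall i, (1 <= i)%N ->
        [/\ start_free (fun z => 'E_(law z)[step z i.+1])%E,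
            start_free (fun z => 'E_(law z)[fun o => (step z i o ^+ 2)%R])%E,
            start_free
              (fun z => 'E_(law z)[fun o => (step z i.+1 o * step z i o)%R])%E &
            start_free
              (fun z => 'E_(law z)[fun o => (step z i.+1 o - step z i o)%R])%E] &
  exists (V : X -> R) (c beta_H beta_g alpha_g alpha_H alpha_V : R),
  [/\ measurable_fun [set: X] V /\ (forall x, 1 <= V x),
      0 <= beta_H <= 2^-1 /\ 0 <= beta_g <= 2^-1,
      [/\ 0 <= alpha_g, 0 <= alpha_H & 0 <= alpha_V] &
  forall t x, Rs 0%N t ->
  let z := Z t x in
  [/\ forall i t', Rs i t' ->
        enorm (H t' x) <= c * xi i `^ alpha_H * V x `^ beta_H,
      forall i, ('E_(law z)[V \o state z i]
                 <= (c * xi i `^ alpha_V * V x)%:E)%E,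
      forall i t', Rs i t' ->
        enorm (g t' x) + enorm (Pg t' x)
        <= c * xi i `^ alpha_g * V x `^ beta_g,
      let D i (o : sa_space z) :=
        enorm (Pg (theta z i o) (state z i o)
               - Pg (theta z i.-1 o) (state z i o)) in
      (forall i, (1 <= i)%N -> measurable_fun [set: sa_space z] (D i)) /\
      (\sum_(1 <= i <oo)
         ('E_(law z)[step z i.+1] * (xi i `^ alpha_w)%:E * 'E_(law z)[D i])
       < +oo)%E &
  [/\ (\sum_(1 <= i <oo)
         ('E_(law z)[fun o => (step z i o ^+ 2)%R] *
          (xi i `^ (2 * alpha_w +
             2 * Num.max (alpha_H + beta_H * alpha_V)
                         (alpha_g + beta_g * alpha_V)))%:E)
       < +oo)%E,
      (\sum_(1 <= i <oo)
         ('E_(law z)[fun o => (step z i.+1 o * step z i o)%R] *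
          (xi i `^ (alpha_H + alpha_g + (beta_H + beta_g) * alpha_V))%:E)
       < +oo)%E &
      (\sum_(1 <= i <oo)
         (`| 'E_(law z)[fun o => (step z i.+1 o - step z i o)%R] | *
          (xi i `^ (alpha_w + alpha_g + beta_g * alpha_V))%:E)
       < +oo)%E]]]]].

End conditions.

(* Main.v *)
Require Import Defs.
From HB Require Import structures.
From mathcomp Require Import all_boot all_order all_algebra.
From mathcomp Require Import all_classical all_reals all_analysis.
From mathcomp Require Import measurable_realfun.
From mathcomp Require Import ring lra.

(** The solution of the Poisson equation at [theta] is the series
    [g_theta = sum_k (P_theta^k H_theta - pi_theta(H_theta))], which converges
    geometrically by (G); [P_theta g_theta] is then [g_theta - H_theta +
    pi_theta(H_theta)].  Summing the bounds of (G) with [r = beta_H] gives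
    [|g_theta| + |P_theta g_theta| <= C xi_i^alpha_g V^beta_g] on [R_i] with
    [alpha_g = alpha_H + alpha_M + alpha_rho] and [beta_g = beta_H]
    ([ergodic_poisson]).

    There is no smoothness of [theta |-> P_theta g_theta] to rely on.  What
    makes the increments [P_(theta_i) g_(theta_i) - P_(theta_(i-1)) g_(theta_(i-1))]
    summable is that they vanish unless [U_i <= p_i]: otherwise the step is [0],
    the proposed parameter is the old one, and it is not projected.  The event
    [U_i <= p_i] is independent of [X_i], so the expected increment is at most
    [p_i] times a moment of [V(X_i)] ([expectation_jump]).  All five series are
    thus dominated by the two in hypothesis (c) ([condP_of_bounds]).

    The case [beta_H = 0] needs more, since (G) is available for [r > 0] only
    and a positive exponent [beta_g] would add [beta_g alpha_V] to the exponents
    of [xi_i], for which (c) leaves no room.  There are two remedies.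
    If [alpha_M > 0], then [H] being bounded, the general term of the series is
    at most [2 b] as well as at most [b V^r M rho^k] for a bound [b] of [|H|];
    interpolating replaces [M] by [M^s], and for a suitable [s < 1] the exponent
    gained on [M] pays for the one of [V].
    If [alpha_M = 0], then in fact [E V(X_i) <= C V(x)] for all [i], and
    [alpha_V] can be taken to be [0].  Indeed (G) holds with a uniform constant
    [M], and (c) forces [p_i xi_i^alpha_rho] to vanish: the parameter is kept
    for times much longer than the mixing time [xi_i^alpha_rho] of the kernel, so
    [V(X_i)] has returned to its stationary level before most updates
    ([rare_updates_bound], [uniform_moment]).

    The transition and independence hypotheses are stated for events.
    [disintegration] extends them to functions by uniqueness of measures on a
    product, over the sample space with the sigma-algebra of the past. *)

Set Implicit Arguments.
Unset Strict Implicit.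
Unset Printing Implicit Defensive.
Import Order.TTheory GRing.Theory Num.Theory.
Import numFieldNormedType.Exports.

Local Open Scope classical_set_scope.
Local Open Scope ring_scope.

(** * Real inequalities *)

Section real_powers.
Context {R : realType}.
Implicit Types a b r s x y q : R.

Lemma ler_powR_base r x y : 0 <= r -> 0 <= x -> x <= y -> x `^ r <= y `^ r.
Proof.
move=> r0 x0 xy; apply: ge0_ler_powR => //; rewrite nnegrE//.
exact: le_trans xy.
Qed.

Lemma powR_ge1 x r : 1 <= x -> 0 <= r -> 1 <= x `^ r.
Proof. by move=> x1 r0; rewrite -[leLHS](powRr0 x) ler_powR. Qed.

Lemma powRDpos x r s : 0 < x -> x `^ (r + s) = x `^ r * x `^ s.
Proof. by move=> x0; rewrite powRD// (gt_eqF x0) implybT. Qed.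

(** As [s <= 1], [y `^ s] is concave in [y] and lies below its tangent at [1].
    The weighted arithmetic-geometric mean inequality gives this directly, and
    it serves below both as Bernoulli's and as Jensen's inequality. *)
Lemma powR_le_tangent s y : 0 <= s <= 1 -> 0 <= y -> y `^ s <= 1 - s + s * y.
Proof.
move=> /andP[s0 s1] y0.
have [->|sn0] := eqVneq s 0; first by rewrite powRr0 subr0 mul0r addr0.
have [->|sn1] := eqVneq s 1; first by rewrite powRr1// subrr add0r mul1r.
have s_gt0 : 0 < s by rewrite lt_def sn0.
have s_lt1 : 0 < 1 - s by rewrite subr_gt0 lt_neqAle sn1.
have := @conjugate_powR R (y `^ s) 1 s^-1 (1 - s)^-1 (powR_ge0 _ _) ler01.
rewrite !invr_gt0 !invrK => /(_ s_gt0 s_lt1); rewrite [s + _]addrC subrK.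
move=> /(_ erefl); rewrite mulr1 -powRrM mulfV// powRr1// powR1 mul1r.
by rewrite [y * s]mulrC [_ + (1 - s)]addrC.
Qed.

(** Concavity gives [1 - q^s >= s (1 - q)]: slowing a geometric rate [q] down to
    [q^s] lengthens its time scale by at most the factor [1/s]. *)
Lemma inv_subr_powR_le s q : 0 < s <= 1 -> 0 < q < 1 ->
  (1 - q `^ s)^-1 <= s^-1 * (1 - q)^-1.
Proof.
move=> /andP[s0 s1] /andP[q0 q1].
have : q `^ s <= 1 - s + s * q by rewrite powR_le_tangent ?(ltW s0)// ltW.
have sq : 0 < s * (1 - q) by rewrite mulr_gt0 ?subr_gt0.
move=> h; rewrite -invfM lef_pV2 ?posrE; [lra|lra|nra].
Qed.

Lemma powR_lt1 s q : 0 < s <= 1 -> 0 < q < 1 -> 0 < q `^ s < 1.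
Proof.
move=> /andP[s0 s1] /andP[q0 q1]; rewrite powR_gt0//=.
have : q `^ s <= 1 - s + s * q by rewrite powR_le_tangent ?(ltW s0)// ltW.
have sq : 0 < s * (1 - q) by rewrite mulr_gt0 ?subr_gt0.
lra.
Qed.

(** The smaller of the two bounds is at most [2 b min(1, y)], and
    [min(1, y) <= y^s]. *)
Lemma min_le_powR s b y u : 0 <= s <= 1 -> 0 <= b -> 0 <= y ->
  u <= 2 * b -> u <= b * y -> u <= 2 * b * y `^ s.
Proof.
move=> /andP[s0 s1] b0 y0 u2 uy.
have [y1|/ltW y1] := leP 1 y.
  by rewrite (le_trans u2)// ler_peMr ?mulr_ge0// powR_ge1.
have [yn0|yn0] := eqVneq y 0.
  have u0 : u <= 0 by rewrite -(mulr0 b) -yn0.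
  by rewrite (le_trans u0)// !mulr_ge0// powR_ge0.
rewrite (le_trans uy)// -mulrA mulrCA ler_wpM2l//.
have y_gt0 : 0 < y by rewrite lt_def yn0.
have : y `^ 1 <= y `^ s by apply: ger_powR => //; rewrite y_gt0.
rewrite powRr1// => h; nra.
Qed.

(** For [a <= 1] the ratio [(n / (n + 1))^a] is at least [n / (n + 1)], so the
    relative decrement of [n^-a] is at most [1 / (n + 1)]. *)
Lemma powR_step_diff a n : 0 <= a <= 1 -> (0 < n)%N ->
  `|n.+1%:R `^ (- a) - n%:R `^ (- a)| <= n%:R `^ (- a - 1) :> R.
Proof.
move=> /andP[a0 a1] n0.
have x0 : 0 < n%:R :> R by rewrite ltr0n.
have y0 : 0 < n.+1%:R :> R by rewrite ltr0n.
pose u : R := n%:R / n.+1%:R.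
have u0 : 0 < u by rewrite divr_gt0.
have u1 : u <= 1 by rewrite ler_pdivrMr// mul1r ler_nat.
have uE : n.+1%:R `^ (- a) = n%:R `^ (- a) * u `^ a.
  rewrite /u powRM ?invr_ge0 ?ltW// -powR_inv1 ?(ltW y0)// -powRrM mulN1r.
  by rewrite mulrA -powRDpos// addNr powRr0 mul1r.
have ua : u <= u `^ a.
  by rewrite -[leLHS]powRr1 ?(ltW u0)// ger_powR// u0.
have ua1 : u `^ a <= 1 by have := ler_powR_base a0 (ltW u0) u1; rewrite powR1.
have na0 : 0 <= n%:R `^ (- a) :> R by exact: powR_ge0.
rewrite uE ler0_norm; last by rewrite subr_le0 ler_piMr.
rewrite powRDpos// powR_inv1 ?(ltW x0)//.
rewrite opprB -[X in X - _]mulr1 -mulrBr ler_wpM2l//.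
have : 1 - u `^ a <= n.+1%:R^-1.
  have -> : n.+1%:R^-1 = 1 - u :> R.
    by rewrite /u -[X in X - _](mulfV (lt0r_neq0 y0)) -mulrBl -natrB// subSnn mul1r.
  by rewrite lerD2l lerN2.
by move=> /le_trans; apply; rewrite lef_pV2 ?posrE// ler_nat.
Qed.

(** A summable weight [i^-b xi_i^s] with [xi] nondecreasing forces its terms to
    be [o(1/i)]: compare with the dyadic block [n <= i < 2n]. *)
Lemma summable_powR_vanish (xi : nat -> R) (b s r al e : R) :
  (forall i, 1 <= xi i) -> (forall i, xi i <= xi i.+1) ->
  0 <= b -> b - 1 <= r -> 0 <= al <= s ->
  (\sum_(1 <= i <oo) (i%:R `^ (- b) * xi i `^ s)%:E < +oo)%E ->
  0 < e ->
  exists N, forall n, (N <= n)%N -> n%:R `^ (- r) * xi n `^ al <= e.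
Proof.
move=> xi1 xiS b0 br /andP[al0 als] foo e0.
pose f i : R := i%:R `^ (- b) * xi i `^ s.
have f0 i : 0 <= f i by rewrite mulr_ge0// powR_ge0.
have xiM m n : (m <= n)%N -> xi m <= xi n.
  by apply: (homo_leq (r := <=%R)) => //; exact: le_trans.
have tail0 : (\sum_(n <= k <oo) (f k)%:E)%E @[n --> \oo] --> 0%E.
  apply: nneseries_tail_cvg => [|k _]; last by rewrite lee_fin.
  rewrite (nneseries_split 0 1) => [|k _]; last by rewrite lee_fin.
  by rewrite big_nat1 lte_add_pinfty// ltry.
have /fine_cvgP[Tfin Tcvg] := tail0.
have d0 : 0 < e * 2 `^ (- b) by rewrite mulr_gt0// powR_gt0.
have [N _ HN] : \forall n \near \oo,
    (\sum_(n <= k <oo) (f k)%:E < (e * 2 `^ (- b))%:E)%E.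
  near=> n.
  have Fn : (\sum_(n <= k <oo) (f k)%:E)%E \is a fin_num by near: n.
  rewrite -(fineK Fn) lte_fin; near: n.
  exact: (cvgr_lt _ Tcvg _ d0).
exists N.+1 => n Nn.
have n0 : 0 < n%:R :> R by rewrite ltr0n (leq_trans _ Nn).
have := HN n (ltnW Nn) => /=.
(* Each of the n terms of the block is at least (2n)^-b xi_n^s. *)
have : ((n%:R * ((2 * n%:R) `^ (- b) * xi n `^ s))%:E <=
    \sum_(n <= k <oo) (f k)%:E)%E.
  apply: (@le_trans _ _ (\sum_(n <= k < n + n) (f k)%:E)%E); last first.
    by apply: nneseries_lim_ge => k _ _; rewrite lee_fin.
  rewrite sumEFin lee_fin mulr_natl -[X in _ *+ X](addnK n n) -sumr_const_nat.
  apply: ler_sum_nat => k /andP[nk kn].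
  have k0 : 0 < k%:R :> R by rewrite ltr0n (leq_trans _ nk)// (leq_trans _ Nn).
  apply: ler_pM; rewrite ?powR_ge0//.
    rewrite !powRN lef_pV2 ?posrE ?powR_gt0 ?mulr_gt0//.
    rewrite ler_powR_base ?(ltW k0)// -natrM ler_nat mul2n -addnn.
    exact: ltnW.
  apply: ler_powR_base (xiM _ _ nk) => //; first exact: le_trans als.
  exact: le_trans (xi1 n).
move=> /le_lt_trans/[apply]; rewrite lte_fin.
rewrite powRM ?(ltW n0)// [e * _]mulrC -mulrA mulrCA ltr_pM2l ?powR_gt0//.
move=> /ltW; apply: le_trans.
have -> : n%:R * (n%:R `^ (- b) * xi n `^ s) = n%:R `^ (1 - b) * xi n `^ s.
  by rewrite mulrA powRDpos// powRr1// ltW.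
apply: ler_pM; rewrite ?powR_ge0//.
  by rewrite ler_powR ?lerN2 ?ler1n -?(ltr_nat R)//; lra.
by rewrite ler_powR.
Unshelve. all: by end_near. Qed.

End real_powers.

(** * Iterated kernels and joint measurability *)

(** Along a measurable map with values in [D], trace measurability on [D] is
    ordinary measurability.  Every hypothesis on the arbitrary set of parameters
    is used through the process, which stays in that set. *)
Lemma trace_measurable_comp d0 d1 d2 (T : measurableType d0)
    (T1 : measurableType d1) (T2 : measurableType d2) (D : set T1)
    (f : T1 -> T2) (phi : T -> T1) :
  trace_measurable D f -> measurable_fun [set: T] phi ->
  (forall o, D (phi o)) -> measurable_fun [set: T] (f \o phi).
Proof.
move=> mf mphi Dphi _ B mB; rewrite setTI.
have [S mS SE] : strace measurable D (D `&` f @^-1` B) by apply: mf; exists B.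
have -> : (f \o phi) @^-1` B = phi @^-1` S.
  apply/seteqP; split=> o /=.
  - move=> Bo; have : (D `&` f @^-1` B) (phi o) by split; [exact: Dphi|].
    by rewrite -SE => -[].
  - move=> So; have : (S `&` D) (phi o) by split.
    by rewrite SE => -[].
by rewrite -[X in measurable X]setTI; exact: mphi.
Qed.

Section kernel_powers.
Context {R : realType} {dX : measure_display} {X : measurableType dX}.
Local Open Scope ereal_scope.

Lemma ge0_integral_comp_noparam (k1 k2 : R.-spker X ~> X) x (f : X -> \bar R) :
  (forall y, 0 <= f y) -> measurable_fun [set: X] f ->
  \int[mkcomp_noparam k1 k2 x]_y f y = \int[k1 x]_y \int[k2 y]_z f z.
Proof.
move=> f0 mf.
(* k2 is read as a parameterized kernel that ignores its parameter. *)
rewrite -(integral_kcomp k1 (kernel.kernel_snd k2) x f0 mf).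
exact: eq_measure_integral.
Qed.

Lemma ge0_integral_kpow0 (Q : R.-spker X ~> X) x (f : X -> \bar R) :
  measurable_fun [set: X] f -> \int[kpow Q 0 x]_y f y = f x.
Proof.
move=> mf; rewrite [LHS](_ : _ = \int[\d_x]_y f y)//.
by rewrite integral_dirac// diracT mul1e.
Qed.

Lemma ge0_integral_kpowS (Q : R.-spker X ~> X) k x (f : X -> \bar R) :
  (forall y, 0 <= f y) -> measurable_fun [set: X] f ->
  \int[kpow Q k.+1 x]_y f y = \int[Q x]_y \int[kpow Q k y]_z f z.
Proof. by move=> f0 mf; rewrite ge0_integral_comp_noparam. Qed.

Lemma ge0_integral_kpow1 (Q : R.-spker X ~> X) x (f : X -> \bar R) :
  (forall y, 0 <= f y) -> measurable_fun [set: X] f ->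
  \int[kpow Q 1 x]_y f y = \int[Q x]_y f y.
Proof.
move=> f0 mf; rewrite ge0_integral_kpowS//.
by apply: eq_integral => y _; rewrite ge0_integral_kpow0.
Qed.

End kernel_powers.

Section joint_measurability.
Context {R : realType} {dX dT : measure_display} {X : measurableType dX}
  {T : measurableType dT} (Q : T -> R.-pker X ~> X).
Hypothesis mQ : forall B, measurable B ->
  measurable_fun [set: T * X] (fun oy => Q oy.1 oy.2 B).
Local Open Scope ereal_scope.

(** Moving the parameter into the source turns the whole family into one kernel,
    so that joint measurability of parametric integrals is measurability of the
    integrals of a single kernel. *)
Definition joint_kernel (oy : T * X) : {measure set X -> \bar R} :=
  Q oy.1 oy.2.

HB.instance Definition _ := isKernel.Build _ _ _ _ R joint_kernel mQ.

Let joint_kernel_prob oy : joint_kernel oy [set: X] = 1.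
Proof. exact: prob_kernel. Qed.

HB.instance Definition _ := Kernel_isProbability.Build _ _ _ _ R
  joint_kernel joint_kernel_prob.

Lemma measurable_joint_integral (F : T * X -> \bar R) :
  (forall oy, 0 <= F oy) -> measurable_fun [set: T * X] F ->
  measurable_fun [set: T * X] (fun oy => \int[Q oy.1 oy.2]_z F (oy.1, z)).
Proof.
move=> F0 mF.
apply: (measurable_fun_integral_finite_kernel
  (fun u : (T * X) * X => F (u.1.1, u.2)) joint_kernel) => //=.
apply: measurableT_comp => //; apply: measurable_fun_pair => //.
exact: measurableT_comp measurable_fst.
Qed.

Lemma measurable_joint_kpow (F : T * X -> \bar R) k :
  (forall oy, 0 <= F oy) -> measurable_fun [set: T * X] F ->
  measurable_fun [set: T * X]
    (fun oy => \int[kpow (Q oy.1) k oy.2]_z F (oy.1, z)).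
Proof.
move=> F0 mF.
have mFo o : measurable_fun [set: X] (fun z => F (o, z)).
  by apply: measurableT_comp => //; exact: pair1_measurable.
elim: k => [|k IHk].
  apply: eq_measurable_fun mF => - [t y] _ /=.
  by rewrite (ge0_integral_kpow0 (Q t) _ (mFo t)).
apply: (eq_measurable_fun _ _ (measurable_joint_integral _ IHk)).
  move=> [t y] _; rewrite [LHS]/= -(ge0_integral_kpowS (Q t) k y _ (mFo t))//.
by move=> oy; apply: integral_ge0.
Qed.

End joint_measurability.

(** * Coordinates and the Euclidean norm *)

Section euclidean_norm.
Context {R : realType} {d : nat}.
Implicit Types u v : 'rV[R]_d.

Lemma enorm_ge0 v : 0 <= enorm v.
Proof. exact: sqrtr_ge0. Qed.

Lemma coord_le_enorm v j : `|v ord0 j| <= enorm v.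
Proof.
rewrite -sqrtr_sqr ler_sqrt; last by apply: sumr_ge0 => i _; exact: sqr_ge0.
by rewrite (bigD1 j)//= lerDl sumr_ge0// => i _; exact: sqr_ge0.
Qed.

Lemma enorm_le_sum v : enorm v <= \sum_j `|v ord0 j|.
Proof.
have s0 : 0 <= \sum_j `|v ord0 j| by rewrite sumr_ge0.
rewrite -[leRHS]ger0_norm// -sqrtr_sqr ler_wsqrtr// expr2 mulr_suml.
apply: ler_sum => j _; rewrite -real_normK ?num_real// expr2.
by rewrite ler_wpM2l// (bigD1 j)//= lerDl sumr_ge0.
Qed.

Lemma enorm_le_bound v (b : R) :
  (forall j, `|v ord0 j| <= b) -> enorm v <= d%:R * b.
Proof.
move=> vb; apply: (le_trans (enorm_le_sum v)).
rewrite mulr_natl -[d in leRHS]card_ord -sumr_const.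
by apply: ler_sum => j _; exact: vb.
Qed.

End euclidean_norm.

Section measurable_coordinates.
Context {R : realType} {dT : measure_display} {T : measurableType dT}.

Lemma measurable_entry m n (i : 'I_m) (j : 'I_n) :
  measurable_fun [set: 'M[R]_(m, n)] (fun M : 'M[R]_(m, n) => M i j).
Proof.
move=> _ B mB; rewrite setTI; apply: sub_sigma_algebra.
by exists i, j, B.
Qed.

Lemma measurable_rowP n (f : T -> 'rV[R]_n) :
  (forall j, measurable_fun [set: T] (fun o => f o ord0 j)) ->
  measurable_fun [set: T] f.
Proof.
move=> mf; apply: (measurability (mx_cylinders (R := R) (m := 1) (n := n))).
  by [].
move=> _ [_ [i [j [B mB ->]]] <-].
by rewrite (ord1 i) setTI -[X in measurable X]setTI; exact: (mf j).
Qed.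

Lemma measurable_enorm n (f : T -> 'rV[R]_n) :
  (forall j, measurable_fun [set: T] (fun o => f o ord0 j)) ->
  measurable_fun [set: T] (fun o => enorm (f o)).
Proof.
move=> mf.
have ms : measurable_fun [set: R] (@Num.sqrt R).
  by apply: continuous_measurable_fun; exact: sqrt_continuous.
apply: (measurableT_comp ms); apply: measurable_sum => j.
exact: measurable_funX (mf j).
Qed.

End measurable_coordinates.

(** * The Poisson equation of one kernel *)

Section signed_kernel_integrals.
Context {R : realType} {dX : measure_display} {X : measurableType dX}.

Lemma measurable_joint_Rkpow dT (T : measurableType dT)
    (Q : T -> R.-pker X ~> X) (f : T * X -> R) k :
  (forall B, measurable B ->
    measurable_fun [set: T * X] (fun oy => Q oy.1 oy.2 B)) ->
  measurable_fun [set: T * X] f ->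
  measurable_fun [set: T * X]
    (fun oy => \int[kpow (Q oy.1) k oy.2]_z f (oy.1, z)).
Proof.
move=> mQ mf; apply: measurableT_comp; first exact: fine_measurable.
have mEf : measurable_fun [set: T * X] (EFin \o f) by exact/measurable_EFinP.
under eq_fun do rewrite integralE.
apply: emeasurable_funB.
- apply: eq_measurable_fun (measurable_joint_kpow (Q := Q) mQ k
    (funepos_ge0 _) (measurable_funepos mEf)) => oy _.
  by apply: eq_integral => z _; rewrite !funeposE.
- apply: eq_measurable_fun (measurable_joint_kpow (Q := Q) mQ k
    (funeneg_ge0 _) (measurable_funeneg mEf)) => oy _.
  by apply: eq_integral => z _; rewrite !funenegE.
Qed.

Lemma measurable_Rkpow (Q : R.-pker X ~> X) (f : X -> R) k :
  measurable_fun [set: X] f ->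
  measurable_fun [set: X] (fun y => \int[kpow Q k y]_z f z).
Proof.
move=> mf.
have mQ B : measurable B -> measurable_fun [set: X * X] (fun oy => Q oy.2 B).
  by move=> mB; exact: measurableT_comp (measurable_kernel Q _ mB) _.
have mf2 : measurable_fun [set: X * X] (f \o snd).
  exact: measurableT_comp mf _.
exact: measurableT_comp (measurable_joint_Rkpow k (Q := fun=> Q) mQ mf2)
  (pair1_measurable point).
Qed.

Lemma Rintegral_kpow0 (Q : R.-spker X ~> X) x (f : X -> R) :
  measurable_fun [set: X] f -> \int[kpow Q 0 x]_y f y = f x.
Proof.
move=> mf; rewrite /Rintegral ge0_integral_kpow0//; exact/measurable_EFinP.
Qed.

(** Fubini for the positive and the negative part: integrability for the
    [k.+1]-step kernel makes both iterated integrals finite. *)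
Lemma Rintegral_kpowS (Q : R.-pker X ~> X) k x (f : X -> R) :
  measurable_fun [set: X] f ->
  (forall y, (kpow Q k y).-integrable [set: X] (EFin \o f)) ->
  (kpow Q k.+1 x).-integrable [set: X] (EFin \o f) ->
  \int[kpow Q k.+1 x]_y f y = \int[Q x]_y \int[kpow Q k y]_z f z.
Proof.
move=> mf fk fk1.
have mEf : measurable_fun [set: X] (EFin \o f) by exact/measurable_EFinP.
have mQ B : measurable B -> measurable_fun [set: X * X] (fun oy => Q oy.2 B).
  by move=> mB; exact: measurableT_comp (measurable_kernel Q _ mB) _.
have piece (u : X -> \bar R) : (forall y, 0 <= u y)%E ->
    measurable_fun [set: X] u -> (kpow Q k.+1 x).-integrable [set: X] u ->
    (Q x).-integrable [set: X] (fun y => \int[kpow Q k y]_z u z)%E.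
  move=> u0 mu /integrableP[_]; under eq_integral do rewrite gee0_abs//.
  rewrite ge0_integral_kpowS// => uoo; apply/integrableP; split.
    have mu2 : measurable_fun [set: X * X] (u \o snd).
      exact: measurableT_comp mu _.
    exact: measurableT_comp (measurable_joint_kpow (Q := fun=> Q) mQ k
      (fun oy => u0 oy.2) mu2) (pair1_measurable point).
  by under eq_integral do rewrite gee0_abs ?integral_ge0//.
have p1 := piece _ (funepos_ge0 _) (measurable_funepos mEf)
  (integrable_funepos measurableT fk1).
have p2 := piece _ (funeneg_ge0 _) (measurable_funeneg mEf)
  (integrable_funeneg measurableT fk1).
rewrite /Rintegral integralE !ge0_integral_kpowS//; first last.
- exact: measurable_funepos.
- exact: measurable_funeneg.
rewrite -integralB//; congr fine; apply: eq_integral => y _.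
by rewrite -integralE fineK// integrable_fin_num.
Qed.

End signed_kernel_integrals.

Section scalar_poisson.
Context {R : realType} {dX : measure_display} {X : measurableType dX}.

Definition poisson_series (Q : R.-pker X ~> X) (f : X -> R) (m : R) (x : X) :=
  limn (series (fun k => \int[kpow Q k x]_y f y - m)).

Variables (Q : R.-pker X ~> X) (f : X -> R) (m q : R) (W : X -> R).

Local Notation g := (poisson_series Q f m).
Let a k x := \int[kpow Q k x]_y f y - m.

Hypothesis mf : measurable_fun [set: X] f.
Hypothesis fint : forall k x, (kpow Q k x).-integrable [set: X] (EFin \o f).
Hypothesis q01 : 0 < q < 1.
Hypothesis Wint : forall x, (Q x).-integrable [set: X] (EFin \o W).
Hypothesis aW : forall k x, `|a k x| <= W x * q ^+ k.

Let W_ge0 x : 0 <= W x.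
Proof. by have := aW 0 x; rewrite expr0 mulr1; exact: le_trans. Qed.

Let q_lt1 : `|q| < 1.
Proof. by case/andP: q01 => q0 q1; rewrite gtr0_norm. Qed.

Lemma poisson_series_cvg : forall x, cvgn (series (a^~ x)).
Proof.
move=> x; case/andP: q01 => q0 q1; apply: normed_cvg.
apply: series_le_cvg (@is_cvg_geometric_series _ (W x) q q_lt1) => n.
- exact: normr_ge0.
- by rewrite /= mulr_ge0// exprn_ge0// ltW.
- exact: aW.
Qed.

Lemma poisson_partial_le n x : `|series (a^~ x) n| <= W x / (1 - q).
Proof.
case/andP: q01 => q0 q1.
apply: le_trans (geometric_le_lim n (W_ge0 x) q0 q_lt1).
rewrite /series/=; apply: (le_trans (ler_norm_sum _ _ _)).
by apply: ler_sum => k _; exact: aW.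
Qed.

Lemma poisson_series_le x : `|g x| <= W x / (1 - q).
Proof.
have cv : cvgn (series (a^~ x)) by exact: poisson_series_cvg.
rewrite ler_norml; apply/andP; split.
- apply: limr_ge => //; near=> n.
  by have := poisson_partial_le n x; rewrite ler_norml => /andP[].
- apply: limr_le => //; near=> n.
  by have := poisson_partial_le n x; rewrite ler_norml => /andP[].
Unshelve. all: by end_near. Qed.

Let measurable_a k : measurable_fun [set: X] (a k).
Proof. by apply: measurable_funB => //; exact: measurable_Rkpow. Qed.

Let measurable_partial n : measurable_fun [set: X] (fun x => series (a^~ x) n).
Proof. by apply: measurable_sum => k; exact: measurable_a. Qed.

Lemma measurable_poisson_series : measurable_fun [set: X] g.
Proof.
apply: (measurable_fun_cvg measurable_partial) => x _.
exact: poisson_series_cvg.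
Qed.

Let Wint' x : (Q x).-integrable [set: X] (EFin \o (fun y => W y / (1 - q))).
Proof.
have -> : EFin \o (fun y => W y / (1 - q))
    = (fun y => ((1 - q)^-1)%:E * (EFin \o W) y)%E.
  by apply/funext => y /=; rewrite -EFinM mulrC.
exact: integrableZl.
Qed.

Let integrable_le x (u : X -> R) : measurable_fun [set: X] u ->
  (forall y, `|u y| <= W y / (1 - q)) ->
  (Q x).-integrable [set: X] (EFin \o u).
Proof.
move=> mu uW; apply: (le_integrable measurableT _ _ (Wint' x)).
  exact/measurable_EFinP.
move=> y _; rewrite /= lee_fin (le_trans (uW y))//; exact: ler_norm.
Qed.

Lemma integrable_poisson_series x : (Q x).-integrable [set: X] (EFin \o g).
Proof.
exact: integrable_le measurable_poisson_series poisson_series_le.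
Qed.

Let integrable_a k x : (Q x).-integrable [set: X] (EFin \o a k).
Proof.
case/andP: q01 => q0 q1.
apply: integrable_le => [|y]; first exact: measurable_a.
rewrite (le_trans (aW k y))// ler_wpM2l//.
rewrite (@le_trans _ _ 1)//; first by rewrite exprn_ile1// ltW.
by rewrite invf_ge1 ?subr_gt0// lerBlDr lerDl ltW.
Qed.

Let integrable_m x : (Q x).-integrable [set: X] (EFin \o cst m).
Proof.
apply/integrableP; split; first by apply/measurable_EFinP.
by rewrite /= integral_cst// [Q x _]prob_kernel mule1 ltry.
Qed.

Let integral_a k x : \int[Q x]_y a k y = a k.+1 x.
Proof.
rewrite /a RintegralB//; last first.
  rewrite [X in _.-integrable _ X](_ : _ =
      (fun y => (EFin \o a k) y + (EFin \o cst m) y)%E); last first.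
    by apply/funext => y /=; rewrite -EFinD /a subrK.
  by apply: integrableD => //; exact: integrable_m.
rewrite -Rintegral_kpowS// Rintegral_cst//.
by rewrite [Q x _]prob_kernel mulr1.
Qed.

Let integral_partial n x :
  \int[Q x]_y series (a^~ y) n = series (a^~ x) n.+1 - a 0 x.
Proof.
elim: n => [|n IHn].
  rewrite /series/= big_nat1 subrr.
  under eq_Rintegral do rewrite big_geq//.
  by rewrite Rintegral_cst// mul0r.
under eq_Rintegral do rewrite [series _ _]big_nat_recr//=.
rewrite RintegralD//; last first.
  apply: integrable_le => [|y]; first exact: measurable_partial n.
  exact: poisson_partial_le n y.
rewrite integral_a [X in X + _]IHn.
by rewrite [series _ n.+2]/series/= [in RHS]big_nat_recr//= addrAC.
Qed.

(** [Q] shifts the series by one term, so [g - Q g] telescopes to its first term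
    [f - m]; the geometric bound by [W] lets [Q] pass to the limit. *)
Lemma poisson_equation x : g x - \int[Q x]_y g y = f x - m.
Proof.
suff -> : \int[Q x]_y g y = g x - a 0 x.
  by rewrite opprB addrC subrK /a Rintegral_kpow0.
have cv y : cvgn (series (a^~ y)) by exact: poisson_series_cvg.
have c1 : (\int[Q x]_y (series (a^~ y) n)%:E)%E @[n --> \oo] -->
    (\int[Q x]_y (g y)%:E)%E.
  apply: (dominated_cvg measurableT _ _ _ (Wint' x)) => //.
  - by move=> n; apply/measurable_EFinP; exact: measurable_partial.
  - by move=> y _; apply: cvg_EFin; [exact: nearW|exact: cv].
  - by move=> n y _; rewrite lee_fin poisson_partial_le.
have c2 : (\int[Q x]_y (series (a^~ y) n)%:E)%E @[n --> \oo] -->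
    (g x - a 0 x)%:E.
  rewrite (_ : (fun n => _) = (fun n => (series (a^~ x) n.+1 - a 0 x)%:E)).
    apply: cvg_EFin; first exact: nearW.
    apply: cvgB; last exact: cvg_cst.
    by rewrite (cvg_shiftS (series (a^~ x))); exact: cv.
  apply/funext => n; rewrite -integral_partial fineK//.
  apply: integrable_fin_num => //; apply: integrable_le => [|y].
    exact: measurable_partial.
  exact: poisson_partial_le.
by rewrite /Rintegral (cvg_unique _ c1 c2).
Qed.

End scalar_poisson.

(** * Solving the Poisson equation under geometric ergodicity *)

Section vector_poisson.
Context {R : realType} {d : nat} {dX : measure_display}
  {X : measurableType dX}.

Definition poisson_sum (Q : R.-pker X ~> X) (mu : probability X R)
    (f : X -> 'rV[R]_d) (x : X) : 'rV[R]_d :=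
  \row_j poisson_series Q (fun y => f y ord0 j) (\int[mu]_y (f y ord0 j)) x.

(** [limn] has a value even for divergent sequences.  The genuine convergence is
    recorded because measurability in the parameter is obtained from limits. *)
Definition poisson_sum_cvg (Q : R.-pker X ~> X) (mu : probability X R)
    (f : X -> 'rV[R]_d) : Prop :=
  forall x j, cvgn (series (fun k =>
    \int[kpow Q k x]_y (f y ord0 j) - \int[mu]_y (f y ord0 j))).

Lemma poisson_sumP (Q : R.-pker X ~> X) (mu : probability X R)
    (f : X -> 'rV[R]_d) (q : R) (W : X -> R) :
  measurable_fun [set: X] f -> (forall k x, vintegrable (kpow Q k x) f) ->
  0 < q < 1 ->
  ('I_d -> forall x, (Q x).-integrable [set: X] (EFin \o W)) ->
  (forall k x (j : 'I_d),
     `|(vintegral (kpow Q k x) f - vintegral mu f) ord0 j| <= W x * q ^+ k) ->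
  let g := poisson_sum Q mu f in
  [/\ measurable_fun [set: X] g, forall x, vintegrable (Q x) g,
      forall x, g x - vintegral (Q x) g = f x - vintegral mu f,
      forall x, enorm (g x) + enorm (vintegral (Q x) g)
                <= 3 * d%:R * (W x / (1 - q)) &
      poisson_sum_cvg Q mu f].
Proof.
move=> mf fint q01 Wint aW g.
pose gj j := poisson_series Q (fun y => f y ord0 j) (\int[mu]_y (f y ord0 j)).
have gE j x : g x ord0 j = gj j x by rewrite mxE.
have mfj j : measurable_fun [set: X] (fun x => f x ord0 j).
  exact: measurableT_comp (measurable_entry _ _) mf.
have aWj j k x :
    `|\int[kpow Q k x]_y (f y ord0 j) - \int[mu]_y (f y ord0 j)| <= W x * q ^+ k.
  by have := aW k x j; rewrite !mxE.
have fj j k x : (kpow Q k x).-integrable [set: X] (EFin \o (fun y => f y ord0 j)).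
  exact: fint.
have eqj j x : g x ord0 j - \int[Q x]_y (g y ord0 j)
    = f x ord0 j - \int[mu]_y (f y ord0 j).
  rewrite gE; under eq_Rintegral do rewrite gE.
  exact: (poisson_equation (mfj j) (fj j) q01 (Wint j) (aWj j)).
have leg j x : `|g x ord0 j| <= W x / (1 - q).
  by rewrite gE; exact: (poisson_series_le q01 (aWj j)).
have lePg j x : `|\int[Q x]_y (g y ord0 j)| <= 2 * (W x / (1 - q)).
  have -> : \int[Q x]_y (g y ord0 j)
      = g x ord0 j - (f x ord0 j - \int[mu]_y (f y ord0 j)).
    by rewrite -eqj opprB addrC subrK.
  rewrite (le_trans (ler_normB _ _))// mulr_natl mulr2n lerD//.
  have := aWj j 0 x; rewrite Rintegral_kpow0// expr0 mulr1 => h.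
  rewrite (le_trans h)// ler_peMr//; first exact: le_trans h.
  by case/andP: q01 => q0 q1; rewrite invf_ge1 ?subr_gt0// gerBl ltW.
split.
- apply: measurable_rowP => j; under eq_fun do rewrite gE.
  exact: (measurable_poisson_series (mfj j) q01 (aWj j)).
- move=> x j; under eq_fun do rewrite gE.
  exact: (integrable_poisson_series (mfj j) q01 (Wint j) (aWj j)).
- by move=> x; apply/rowP => j; have := eqj j x; rewrite !mxE.
- move=> x.
  have h1 := enorm_le_bound (leg ^~ x).
  have h2 : enorm (vintegral (Q x) g) <= d%:R * (2 * (W x / (1 - q))).
    by apply: enorm_le_bound => j; rewrite mxE.
  by rewrite (le_trans (lerD h1 h2))//; lra.
- by move=> x j; exact: (poisson_series_cvg q01 (aWj j)).
Qed.

End vector_poisson.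

Section ergodicity.
Context {R : realType} {dX : measure_display} {X : measurableType dX}.

Lemma integrable_kpow1 (Q : R.-pker X ~> X) x (f : X -> R) :
  (kpow Q 1 x).-integrable [set: X] (EFin \o f) ->
  (Q x).-integrable [set: X] (EFin \o f).
Proof.
move=> /integrableP[mf foo]; apply/integrableP; split=> //.
rewrite -(ge0_integral_kpow1 Q x)//; exact: measurableT_comp.
Qed.

Lemma Rintegral_le_bound (mu : {measure set X -> \bar R}) (f : X -> R) (b : R) :
  (mu [set: X] <= 1)%E -> mu.-integrable [set: X] (EFin \o f) ->
  (forall x, `|f x| <= b) -> 0 <= b -> `|\int[mu]_x f x| <= b.
Proof.
move=> mu1 fint fb b0.
have mf := measurable_int _ fint.
rewrite -lee_fin EFin_normr_Rintegral//.
apply: (le_trans (le_abse_integral _ _ _)) => //.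
apply: (@le_trans _ _ (\int[mu]_x b%:E)%E).
  apply: ge0_le_integral => //; first exact: measurableT_comp.
  by move=> x _; rewrite lee_fin.
by rewrite integral_cst// -[leRHS]mule1 lee_wpmul2l// lee_fin.
Qed.

Lemma Vnorm_le_bound n (V : X -> R) (r b : R) (f : X -> 'rV[R]_n) :
  (forall x, 1 <= V x) -> 0 <= b -> (forall x, enorm (f x) <= b * V x `^ r) ->
  (Vnorm V r f < +oo)%E /\ fine (Vnorm V r f) <= b.
Proof.
move=> V1 b0 fb.
have h : (Vnorm V r f <= b%:E)%E.
  apply: ge_ereal_sup => _ [x _ <-]; rewrite lee_fin ler_pdivrMr//.
  by rewrite powR_gt0// (lt_le_trans ltr01).
split; first exact: le_lt_trans h (ltry _).
by move: h; case: (Vnorm V r f) => //=; rewrite ?lee_fin.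
Qed.

End ergodicity.

Section ergodic_family.
Context {R : realType} {d : nat} {dX : measure_display}
  {X : measurableType dX}.
Variables (P : 'rV[R]_d -> R.-pker X ~> X) (pi : 'rV[R]_d -> probability X R)
  (Rs : nat -> set 'rV[R]_d) (xi : nat -> R) (V : X -> R).
Variables (alpha_M alpha_rho : R).
Hypothesis mV : measurable_fun [set: X] V.
Hypothesis V1 : forall x, 1 <= V x.
Hypothesis xi1 : forall i, 1 <= xi i.
Hypothesis G : condG P pi Rs xi V alpha_M alpha_rho.

(** Geometric ergodicity for the function all of whose coordinates are [V^e];
    it says something about [V] only if there is a coordinate at all. *)
Lemma integrable_Vpow t (e : R) x : Theta_hat Rs t -> 0 < e <= 1 -> 'I_d ->
  (P t x).-integrable [set: X] (EFin \o (fun y => V y `^ e)).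
Proof.
move=> ht e01 j; have [_ _ /(_ e e01)[M [rho [c_r [_ _ Gt _]]]]] := G.
pose f y : 'rV[R]_d := const_mx (V y `^ e).
have mVe : measurable_fun [set: X] (fun y => V y `^ e).
  exact: measurableT_comp (measurable_powR e) mV.
have mf : measurable_fun [set: X] f.
  by apply: measurable_rowP => i; under eq_fun do rewrite mxE.
have [foo _] : (Vnorm V e f < +oo)%E /\ fine (Vnorm V e f) <= d%:R.
  apply: Vnorm_le_bound => // x'; apply: enorm_le_bound => i.
  by rewrite mxE ger0_norm ?powR_ge0.
have [_ /(_ 1%N x)[fint _]] := Gt t ht f mf foo.
have := fint j; under eq_fun do rewrite mxE.
exact: integrable_kpow1.
Qed.

(** Summing [|P^k H - pi(H)| <= b (V^r M rho^k)] over [k] costs a factor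
    [M / (1 - rho)].  When [H] is bounded, interpolating with the trivial bound
    [2 b] trades it for [M^s / (s (1 - rho))], for any [s] in [(0, 1]], and at
    the same time lowers the exponent of [V] from [r] to [r s]. *)
Lemma ergodic_poisson (H : 'rV[R]_d -> X -> 'rV[R]_d) (c alpha_H r s : R) :
  (forall t, Theta_hat Rs t -> measurable_fun [set: X] (H t)) ->
  0 <= c -> 0 < r <= 1 -> 0 < s <= 1 ->
  (forall i t x, Rs i t -> enorm (H t x) <= c * xi i `^ alpha_H * V x `^ r) ->
  s = 1 \/ (forall i t x, Rs i t -> enorm (H t x) <= c * xi i `^ alpha_H) ->
  let g t := poisson_sum (P t) (pi t) (H t) in
  (forall t, Theta_hat Rs t -> poisson_solution P pi H t (g t) /\
    poisson_sum_cvg (P t) (pi t) (H t)) /\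
  exists2 C, 0 <= C & forall i t x, Rs i t ->
    enorm (g t x) + enorm (vintegral (P t x) (g t))
    <= C * xi i `^ (alpha_H + s * alpha_M + alpha_rho) * V x `^ (r * s).
Proof.
move=> mH c0 r01 s01 HV Hs g.
have /andP[r0 r1] := r01; have /andP[s0 s1] := s01.
have [_ _ /(_ r r01)[M [rho [c_r [cr0 Mrho Gt Mbd]]]]] := G.
have key i t : Rs i t ->
    let b := c * xi i `^ alpha_H in
    let W x := 2 * b * (V x `^ (r * s) * M t `^ s) in
    (poisson_solution P pi H t (g t) /\
     poisson_sum_cvg (P t) (pi t) (H t)) /\
    forall x, enorm (g t x) + enorm (vintegral (P t x) (g t))
      <= 3 * d%:R * (W x / (1 - rho t `^ s)).
  move=> Rit b W.
  have ht : Theta_hat Rs t by exists i.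
  have b0 : 0 <= b by rewrite mulr_ge0// powR_ge0.
  have [M0 rho01] := Mrho t ht; have /andP[rho0 rho1] := rho01.
  have [Hoo Hb] := Vnorm_le_bound V1 b0 (fun x => HV i t x Rit).
  have [Hpi Hk] := Gt t ht _ (mH t ht) Hoo.
  have V0 x : 0 < V x `^ r by rewrite powR_gt0// (lt_le_trans ltr01).
  have aW k x (j : 'I_d) :
      `|(vintegral (kpow (P t) k x) (H t) - vintegral (pi t) (H t)) ord0 j|
      <= W x * (rho t `^ s) ^+ k.
    have y0 : 0 <= V x `^ r * M t * rho t ^+ k.
      by rewrite !mulr_ge0// ?(ltW (V0 x))// exprn_ge0// ltW.
    have WE : W x * (rho t `^ s) ^+ k
        = 2 * b * (V x `^ r * M t * rho t ^+ k) `^ s.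
      rewrite powRM ?mulr_ge0 ?exprn_ge0 ?(ltW (V0 x)) ?(ltW rho0)//.
      rewrite powRM ?(ltW (V0 x))// -powRrM.
      by rewrite -powR_mulrn ?powR_ge0// powRAC powR_mulrn ?(ltW rho0)// /W !mulrA.
    have h1 : `|(vintegral (kpow (P t) k x) (H t)
        - vintegral (pi t) (H t)) ord0 j| <= b * (V x `^ r * M t * rho t ^+ k).
      apply: (le_trans (coord_le_enorm _ j)); apply: (le_trans (Hk k x).2).
      have -> : V x `^ r * fine (Vnorm V r (H t)) * M t * rho t ^+ k
          = fine (Vnorm V r (H t)) * (V x `^ r * M t * rho t ^+ k) by ring.
      exact: ler_wpM2r.
    rewrite WE; case: Hs => [->|Hbd].
      rewrite powRr1// (le_trans h1)// -[2 * b * _]mulrA ler_peMl ?ler1n//.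
      exact: mulr_ge0.
    apply: min_le_powR h1 => //; first by rewrite (ltW s0).
    have Hbj x' : `|H t x' ord0 j| <= b.
      exact: le_trans (coord_le_enorm _ j) (Hbd _ _ _ Rit).
    rewrite !mxE (le_trans (ler_normB _ _))// mulr_natl mulr2n.
    apply: lerD; apply: Rintegral_le_bound => //.
    - exact: sprob_kernel_le1.
    - exact: (Hk k x).1.
    - exact: (probability_le1 (pi t) measurableT).
    - exact: Hpi.
  have Wint (j : 'I_d) x : (P t x).-integrable [set: X] (EFin \o W).
    have -> : EFin \o W = (fun y =>
        (2 * b * M t `^ s)%R%:E * (EFin \o (fun y => V y `^ (r * s))%R) y)%E.
      by apply/funext => y; rewrite /= -EFinM /W; congr EFin; ring.
    apply: integrableZl => //; apply: integrable_Vpow => //.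
    by rewrite mulr_gt0//= mulr_ile1 ?(ltW r0) ?(ltW s0).
  have [mg gint geq gle gcvg] := poisson_sumP (mH t ht) (fun k x => (Hk k x).1)
    (powR_lt1 s01 rho01) Wint aW.
  by split.
split=> [t [i _ Rit]|]; first exact: (key i t Rit).1.
exists (6 * d%:R * c * (c_r `^ s * (s^-1 * c_r))).
  by rewrite !mulr_ge0// ?powR_ge0// invr_ge0 ltW.
move=> i t x Rit; have [_ /(_ x) gle] := key i t Rit.
have ht : Theta_hat Rs t by exists i.
have [M0 rho01] := Mrho t ht; have [Mle rle] := Mbd i t Rit.
have xi0 : 0 < xi i by rewrite (lt_le_trans ltr01).
apply: (le_trans gle).
have h1 : (1 - rho t `^ s)^-1 <= s^-1 * (c_r * xi i `^ alpha_rho).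
  rewrite (le_trans (inv_subr_powR_le s01 rho01))// ler_wpM2l//.
  by rewrite invr_ge0 ltW.
have h2 : M t `^ s <= c_r `^ s * xi i `^ (s * alpha_M).
  rewrite [s * _]mulrC powRrM -powRM ?powR_ge0//.
  by apply: ler_powR_base => //; exact: ltW.
have -> : 3 * d%:R * (2 * (c * xi i `^ alpha_H) * (V x `^ (r * s) * M t `^ s)
      / (1 - rho t `^ s))
    = 6 * d%:R * c * xi i `^ alpha_H * V x `^ (r * s)
      * (M t `^ s * (1 - rho t `^ s)^-1) by ring.
have -> : 6 * d%:R * c * (c_r `^ s * (s^-1 * c_r))
      * xi i `^ (alpha_H + s * alpha_M + alpha_rho) * V x `^ (r * s)
    = 6 * d%:R * c * xi i `^ alpha_H * V x `^ (r * s)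
      * ((c_r `^ s * xi i `^ (s * alpha_M)) * (s^-1 * (c_r * xi i `^ alpha_rho))).
  by rewrite !powRDpos//; ring.
rewrite ler_wpM2l ?mulr_ge0 ?powR_ge0// ler_pM ?powR_ge0// invr_ge0 subr_ge0.
by case/andP: (powR_lt1 s01 rho01) => _ /ltW.
Qed.

End ergodic_family.

(** * Disintegration of a joint law *)

Section disintegration.
Context {R : realType} {dW dF dX : measure_display} {W : measurableType dW}
  {F : measurableType dF} {X : measurableType dX}.
Variables (Pr : probability W R) (iota : W -> F) (Y : W -> X)
  (kap : R.-pker F ~> X).
Hypotheses (miota : measurable_fun [set: W] iota)
  (mY : measurable_fun [set: W] Y).
Hypothesis condY : forall (A : set F) (B : set X),
  measurable A -> measurable B ->
  Pr (iota @^-1` A `&` Y @^-1` B)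
  = (\int[Pr]_(o in iota @^-1` A) kap (iota o) B)%E.
Local Open Scope ereal_scope.

Let mpair : measurable_fun [set: W] (fun o => (iota o, Y o)).
Proof. exact: measurable_fun_pair. Qed.

(** The joint law of [(iota, Y)] and its disintegration along [kap] are packaged
    as a measure and as a composition of kernels, with a one-point source, so
    that uniqueness of measures and integration along compositions apply. *)
Definition joint_law : {measure set (F * X) -> \bar R}.
Proof. refine (pushforward Pr (fun o => (iota o, Y o))); exact: mpair. Defined.

Definition base_kernel (_ : unit) : {measure set F -> \bar R}.
Proof. refine (pushforward Pr iota); exact: miota. Defined.

Definition graph_kernel (uo : unit * F) : {measure set (F * X) -> \bar R}.
Proof.
refine (pushforward (kap uo.2) (pair uo.2)); exact: pair1_measurable.
Defined.

Let measurable_base_kernel B : measurable B ->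
  measurable_fun [set: unit] (base_kernel ^~ B).
Proof. by move=> mB; exact: measurable_cst. Qed.

HB.instance Definition _ :=
  isKernel.Build _ _ _ _ R base_kernel measurable_base_kernel.

Let base_kernel_prob u : base_kernel u [set: F] = 1.
Proof. by rewrite /= /pushforward preimage_setT probability_setT. Qed.

HB.instance Definition _ :=
  Kernel_isProbability.Build _ _ _ _ R base_kernel base_kernel_prob.

Let measurable_graph_kernel B : measurable B ->
  measurable_fun [set: unit * F] (graph_kernel ^~ B).
Proof.
move=> mB.
have m1 : measurable_fun [set: F] (fun x => \int[kap x]_y (\1_B (x, y))%:E).
  apply: (measurable_fun_integral_finite_kernel
    (fun z => (\1_B z)%:E) kap) => //.
  exact/measurable_EFinP.
apply: eq_measurable_fun (measurableT_comp m1 measurable_snd) => -[u x] _ /=.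
rewrite /pushforward; transitivity (\int[kap x]_y (\1_(pair x @^-1` B) y)%:E).
  by apply: eq_integral => y _; rewrite !indicE.
rewrite integral_indic ?setIT// -[X in measurable X]setTI.
exact: pair1_measurable.
Qed.

HB.instance Definition _ :=
  isKernel.Build _ _ _ _ R graph_kernel measurable_graph_kernel.

Let graph_kernel_prob u : graph_kernel u [set: F * X] = 1.
Proof. exact: (prob_kernel (s := kap) u.2). Qed.

HB.instance Definition _ :=
  Kernel_isProbability.Build _ _ _ _ R graph_kernel graph_kernel_prob.

Let joint_lawE C : measurable C ->
  joint_law C = mkcomp base_kernel graph_kernel tt C.
Proof.
pose rect := [set A `*` B | A in @measurable _ F & B in @measurable _ X].
apply: (@measure_unique _ _ _ rect (fun=> setT)).
- exact: measurable_prod_measurableType.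
- move=> _ _ [A1 mA1 [B1 mB1 <-]] [A2 mA2 [B2 mB2 <-]].
  exists (A1 `&` A2); first exact: measurableI.
  by exists (B1 `&` B2); [exact: measurableI|rewrite setXI].
- by move=> _; exists setT => //; exists setT => //; rewrite setXTT.
- by rewrite bigcup_const.
- move=> _ [A mA [B mB <-]].
  rewrite /= /mkcomp/= /kcomp/= ge0_integral_pushforward//; last first.
    by move=> x _; exact: (measure_ge0 (kap x)).
    have mAB : measurable (A `*` B) by exact: measurableX.
    exact: measurableT_comp (measurable_graph_kernel mAB)
      (pair1_measurable tt).
  transitivity (Pr (iota @^-1` A `&` Y @^-1` B)); first by [].
  rewrite condY// preimage_setT [LHS]integral_mkcond.
  apply: eq_integral => o _; rewrite patchE /= /pushforward.
  have [Ao|Ao] := pselect (A (iota o)).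
    rewrite ifT ?inE//; congr (kap _ _).
    by apply/seteqP; split=> y //= -[].
  rewrite ifF; last by apply/negbTE/negP; rewrite inE.
  rewrite [X in kap _ X](_ : _ = set0) ?measure0//.
  by apply/seteqP; split=> y //= -[].
- move=> _; rewrite /= /pushforward preimage_setT.
  by rewrite probability_setT ltry.
Qed.

(** [condY] says that the joint law of [(iota, Y)] and the composition of the
    law of [iota] with [kap] agree on rectangles, a pi-system generating the
    product sigma-algebra; hence they integrate every function alike. *)
Lemma disintegration (f : F * X -> \bar R) :
  (forall z, 0 <= f z) -> measurable_fun [set: F * X] f ->
  \int[Pr]_o f (iota o, Y o) = \int[Pr]_o \int[kap (iota o)]_y f (iota o, y).
Proof.
move=> f0 mf; transitivity (\int[joint_law]_z f z).
  by rewrite /= ge0_integral_pushforward// => z _; exact: f0.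
rewrite (eq_measure_integral (mkcomp base_kernel graph_kernel tt)); last first.
  by move=> C mC _; exact: joint_lawE.
rewrite (integral_kcomp base_kernel graph_kernel tt f0 mf) /=.
have mk : measurable_fun [set: F]
    (fun y => \int[graph_kernel (tt, y)]_z f z).
  have m1 : measurable_fun [set: unit * F]
      (fun uo => \int[graph_kernel uo]_z f z).
    by apply: measurable_fun_integral_kernel => // B mB;
      exact: measurable_graph_kernel.
  exact: measurableT_comp m1 (pair1_measurable tt).
rewrite ge0_integral_pushforward//; last by move=> o _; exact: integral_ge0.
rewrite preimage_setT; apply: eq_integral => o _ /=.
rewrite ge0_integral_pushforward//.
Qed.

End disintegration.

Section independence_integral.
Context {R : realType} {dW dF : measure_display} {W : measurableType dW}
  {F : measurableType dF}.
Variables (Pr : probability W R) (iota : W -> F) (Y : {mfun W >-> R}).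
Hypothesis miota : measurable_fun [set: W] iota.
Hypothesis indepY : forall (A : set F) (B : set R),
  measurable A -> measurable B ->
  Pr (iota @^-1` A `&` Y @^-1` B) = (Pr (iota @^-1` A) * Pr (Y @^-1` B))%E.
Local Open Scope ereal_scope.

Definition law_kernel (_ : F) : {measure set R -> \bar R} := distribution Pr Y.

Let measurable_law_kernel B : measurable B ->
  measurable_fun [set: F] (law_kernel ^~ B).
Proof. by move=> mB; exact: measurable_cst. Qed.

HB.instance Definition _ :=
  isKernel.Build _ _ _ _ R law_kernel measurable_law_kernel.

Let law_kernel_prob o : law_kernel o [set: R] = 1.
Proof. exact: (probability_setT (distribution Pr Y)). Qed.

HB.instance Definition _ :=
  Kernel_isProbability.Build _ _ _ _ R law_kernel law_kernel_prob.

(** Independence is disintegration along a constant kernel, the law of [Y]. *)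
Lemma ge0_integral_indep (f : F -> \bar R) (B : set R) : measurable B ->
  (forall o, 0 <= f o) -> measurable_fun [set: F] f ->
  \int[Pr]_(o in Y @^-1` B) f (iota o)
  = Pr (Y @^-1` B) * \int[Pr]_o f (iota o).
Proof.
move=> mB f0 mf.
have mI : measurable_fun [set: R] (fun y => (\1_B y)%:E : \bar R).
  exact/measurable_EFinP.
have I0 y : 0 <= (\1_B y)%:E :> \bar R by rewrite lee_fin.
transitivity (\int[Pr]_o (f (iota o) * (\1_B (Y o))%:E)).
  rewrite integral_mkcond; apply: eq_integral => o _.
  rewrite patchE indicE /=; case: (pselect (B (Y o))) => BY.
    by rewrite ifT ?inE// mem_set// mule1.
  by rewrite ifF ?memNset// mule0.
rewrite (disintegration (Pr := Pr) (iota := iota) (Y := Y) (kap := law_kernel)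
  miota _ _ (f := fun z => f z.1 * (\1_B z.2)%:E))//=; first last.
- apply: emeasurable_funM; first exact: measurableT_comp mf _.
  exact: measurableT_comp mI _.
- by move=> z; rewrite mule_ge0.
- move=> A C mA mC; rewrite indepY// integral_cst; last first.
    by rewrite -[X in measurable X]setTI; exact: miota.
  by rewrite muleC.
have mfi : measurable_fun [set: W] (fun o => f (iota o)).
  exact: measurableT_comp mf miota.
rewrite muleC -ge0_integralZr//; apply: eq_integral => o _.
by rewrite ge0_integralZl// integral_indic// setIT.
Qed.

End independence_integral.

(** * The process *)

Section process_facts.
Context {R : realType} {d : nat} {dX : measure_display}
  {X : measurableType dX}.
Variables (Theta : set 'rV[R]_d) (P : 'rV[R]_d -> R.-pker X ~> X)
  (pi : 'rV[R]_d -> probability X R) (H : 'rV[R]_d -> X -> 'rV[R]_d)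
  (Rs : nat -> set 'rV[R]_d) (z : sa_data R d X) (t0 : 'rV[R]_d) (x0 : X).
Hypothesis P_measurable : forall B : set X, measurable B ->
  trace_measurable (Theta `*` [set: X]) (fun tx => P tx.1 tx.2 B).
Hypothesis H_measurable :
  trace_measurable (Theta `*` [set: X]) (fun tx => H tx.1 tx.2).
Hypothesis RsS : forall i, Rs i `<=` Rs i.+1.
Hypothesis hatTheta : Theta_hat Rs `<=` Theta.
Hypothesis pr : sa_process_from P H Rs z t0 x0.
Hypothesis Rs0 : Rs 0%N t0.

Lemma theta_in i o : Rs i (theta z i o).
Proof.
case: i => [|i]; first by rewrite (sa_theta0 pr).
rewrite (sa_theta pr); case: ifPn => [|_]; first by rewrite inE.
exact: sa_proj_in pr _ _.
Qed.

Lemma theta_hat_in i o : Theta_hat Rs (theta z i o).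
Proof. by exists i => //; exact: theta_in. Qed.

(** A zero step proposes the current parameter, which already lies in the next
    projection set. *)
Lemma theta_still i o : step z i.+1 o = 0 -> theta z i.+1 o = theta z i o.
Proof.
move=> s0; rewrite (sa_theta pr).
have -> : theta_star H z i.+1 o = theta z i o.
  by rewrite /theta_star /= s0 scale0r addr0.
by rewrite ifT// inE; apply: RsS; exact: theta_in.
Qed.

Section along.
Context {dT : measure_display} {T : measurableType dT}.
Variable tau : T -> 'rV[R]_d.
Hypothesis mtau : measurable_fun [set: T] tau.
Hypothesis tau_in : forall o, Theta_hat Rs (tau o).

Let mpair : measurable_fun [set: T * X] (fun oy => (tau oy.1, oy.2)).
Proof.
by apply: measurable_fun_pair => //; exact: measurableT_comp measurable_fst.
Qed.

Lemma measurable_kernel_along B : measurable B ->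
  measurable_fun [set: T * X] (fun oy => P (tau oy.1) oy.2 B).
Proof.
move=> mB; apply: (trace_measurable_comp (P_measurable mB) mpair) => oy.
by split=> //=; exact: hatTheta (tau_in _).
Qed.

Lemma measurable_H_along j :
  measurable_fun [set: T * X] (fun oy => H (tau oy.1) oy.2 ord0 j).
Proof.
have mH : measurable_fun [set: T * X] (fun oy => H (tau oy.1) oy.2).
  apply: (trace_measurable_comp H_measurable mpair) => oy.
  by split=> //=; exact: hatTheta (tau_in _).
exact: measurableT_comp (measurable_entry ord0 j) mH.
Qed.

Let g t := poisson_sum (P t) (pi t) (H t).

Hypothesis gP : forall t, Theta_hat Rs t -> poisson_solution P pi H t (g t) /\
  poisson_sum_cvg (P t) (pi t) (H t).

Let A j k (oy : T * X) := \int[kpow (P (tau oy.1)) k oy.2]_y (H (tau oy.1) y ord0 j).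

Let mA j k : measurable_fun [set: T * X] (A j k).
Proof.
exact: (measurable_joint_Rkpow (Q := fun o => P (tau o)) k
  measurable_kernel_along (measurable_H_along j)).
Qed.

(** Measurability of [t |-> pi_t(H_t)] comes from the kernels: it is the limit
    of [P_t^k H_t] at any fixed point, as the general term of a convergent
    series tends to [0]. *)
Lemma measurable_mean_along j :
  measurable_fun [set: T] (fun o => \int[pi (tau o)]_y (H (tau o) y ord0 j)).
Proof.
apply: (measurable_fun_cvg (h := fun k o => A j k (o, point))).
  move=> k; exact: measurableT_comp (mA j k) (pair2_measurable point).
move=> o _; have [_ cv] := gP (tau_in o).
by apply/subr_cvg0; exact: (cvg_series_cvg_0 (cv point j)).
Qed.

Lemma measurable_g_along j :
  measurable_fun [set: T * X] (fun oy => g (tau oy.1) oy.2 ord0 j).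
Proof.
apply: (measurable_fun_cvg (h := fun n oy => series (fun k =>
    A j k oy - \int[pi (tau oy.1)]_y (H (tau oy.1) y ord0 j)) n)).
  move=> n; apply: measurable_sum => k; apply: measurable_funB => //.
  exact: measurableT_comp (measurable_mean_along j) _.
move=> oy _; have [_ cv] := gP (tau_in oy.1).
by rewrite mxE; exact: cv.
Qed.

(** [P_t g_t] is read off the Poisson equation as [g_t - (H_t - pi_t(H_t))]. *)
Lemma measurable_Pg_along j : measurable_fun [set: T * X]
  (fun oy => vintegral (P (tau oy.1) oy.2) (g (tau oy.1)) ord0 j).
Proof.
have -> : (fun oy => vintegral (P (tau oy.1) oy.2) (g (tau oy.1)) ord0 j)
  = (fun oy : T * X => g (tau oy.1) oy.2 ord0 j - (H (tau oy.1) oy.2 ord0 j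
       - \int[pi (tau oy.1)]_y (H (tau oy.1) y ord0 j))).
  apply/funext => oy; have [[_ _ _ eqg] _] := gP (tau_in oy.1).
  have := congr1 (fun u : 'rV[R]_d => u ord0 j) (eqg oy.2).
  rewrite !mxE => <-; by rewrite opprB addrC subrK.
apply: measurable_funB; first exact: measurable_g_along.
apply: measurable_funB; first exact: measurable_H_along.
exact: measurableT_comp (measurable_mean_along j) _.
Qed.

End along.

Lemma filt_measurable i A : filt z i A -> measurable A.
Proof.
apply: smallest_sub; first exact: sigma_algebra_measurable.
by move=> B [[j _ [|]]|[j _]] [C mC <-]; exact: measurable_funP.
Qed.

Lemma filtX_measurable i A : filtX z i A -> measurable A.
Proof.
apply: smallest_sub; first exact: sigma_algebra_measurable.
move=> B [|[C mC <-]]; first exact: filt_measurable.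
exact: measurable_funP.
Qed.

(** The same sample space with the smaller sigma-algebras of the past, so that
    adaptedness of a function is its measurability. *)
Local Notation past i := (g_sigma_algebraType (filt z i)).
Local Notation pastX i := (g_sigma_algebraType (filtX z i)).

Lemma measurable_past i A : measurable (A : set (past i)) -> filt z i A.
Proof.
have -> : measurable (A : set (past i)) = <<s filt z i >> A by [].
by rewrite sigma_algebra_id//; exact: smallest_sigma_algebra.
Qed.

Lemma measurable_pastX i A : measurable (A : set (pastX i)) -> filtX z i A.
Proof.
have -> : measurable (A : set (pastX i)) = <<s filtX z i >> A by [].
by rewrite sigma_algebra_id//; exact: smallest_sigma_algebra.
Qed.

Lemma measurable_id_past i :
  measurable_fun [set: sa_space z] (id : sa_space z -> past i).
Proof.
by move=> _ A mA; rewrite setTI; exact: filt_measurable (measurable_past mA).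
Qed.

Lemma measurable_id_pastX i :
  measurable_fun [set: sa_space z] (id : sa_space z -> pastX i).
Proof.
move=> _ A mA; rewrite setTI; exact: filtX_measurable (measurable_pastX mA).
Qed.

Lemma measurable_theta_past i :
  measurable_fun [set: past i] (theta z i : past i -> 'rV[R]_d).
Proof.
move=> _ B mB; apply: sub_sigma_algebra; apply: sub_sigma_algebra.
by left; exists i => //=; left; exists B.
Qed.

Lemma measurable_state_past i :
  measurable_fun [set: past i] (state z i : past i -> X).
Proof.
move=> _ B mB; apply: sub_sigma_algebra; apply: sub_sigma_algebra.
by left; exists i => //=; right; exists B.
Qed.

Lemma measurable_theta_pastX i :
  measurable_fun [set: pastX i] (theta z i : pastX i -> 'rV[R]_d).
Proof.
move=> _ B mB; apply: sub_sigma_algebra; apply: sub_sigma_algebra; left.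
by apply: sub_sigma_algebra; left; exists i => //=; left; exists B.
Qed.

Lemma measurable_state_pastX i :
  measurable_fun [set: pastX i] (state z i.+1 : pastX i -> X).
Proof.
move=> _ B mB; apply: sub_sigma_algebra; apply: sub_sigma_algebra.
by right; exists B.
Qed.

End process_facts.

(** * Moments of the thinned step sizes *)

Section step_moments.
Context {R : realType} {dW : measure_display} {W : measurableType dW}.
Variables (Pr : probability W R) (U : nat -> {mfun W >-> R})
  (gamma p : nat -> R) (Gam : nat -> W -> R).
Hypothesis U_indep : mutually_indep Pr U.
Hypothesis U_uniform : forall i, (1 <= i)%N -> forall B : set R, measurable B ->
  distribution Pr (U i) B = uniform_prob (@ltr01 R) B.
Hypothesis Gam_def : forall i, (1 <= i)%N -> forall o,
  Gam i o = if U i o <= p i then gamma i else 0.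
Hypothesis p01 : forall i, (1 <= i)%N -> 0 <= p i <= 1.

Definition update_set i : set R := `]-oo, p i]%classic.

Lemma measurable_update_set i : measurable (update_set i).
Proof. exact: measurable_itv. Qed.

Lemma update_prob i : (1 <= i)%N -> Pr (U i @^-1` update_set i) = (p i)%:E.
Proof.
move=> i1; have /andP[p0 p1] := p01 i1.
have := U_uniform i1 (measurable_update_set i).
rewrite /distribution /pushforward => ->.
rewrite /uniform_prob integral_uniform_pdf.
have -> : update_set i `&` `[0, 1]%classic = `[0, p i]%classic :> set R.
  apply/seteqP; split=> x /=; rewrite !in_itv/=.
    by move=> [xp /andP[-> _]].
  by move=> /andP[-> xp]; split=> //=; exact: le_trans p1.
rewrite (eq_integral (fun=> 1%:E)); last first.
  move=> x; rewrite inE/= in_itv/= /uniform_pdf => /andP[-> xp].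
  by rewrite (le_trans xp p1) subr0 invr1.
rewrite integral_cst//= mul1e lebesgue_measure_itv/= lte_fin.
by case: ltP => [_|h]; [rewrite oppr0 adde0|congr (_%:E); apply/eqP; rewrite eq_le p0].
Qed.

Lemma step_indic i : (1 <= i)%N ->
  Gam i = (fun o => gamma i * \1_(U i @^-1` update_set i) o).
Proof.
move=> i1; apply/funext => o; rewrite Gam_def// indicE.
have -> : (o \in U i @^-1` update_set i) = (U i o <= p i).
  by apply/idP/idP; rewrite inE /update_set/= in_itv.
by case: ifP; rewrite ?mulr1 ?mulr0.
Qed.

Let mA i : measurable (U i @^-1` update_set i).
Proof. by apply: measurable_funPTI; exact: measurable_update_set. Qed.

Let integral_scaled_indic (a : R) (A : set W) : measurable A ->
  (\int[Pr]_o (a * \1_A o)%:E = a%:E * Pr A)%E.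
Proof.
move=> A_meas; under eq_integral do rewrite EFinM.
by rewrite integralZl ?integral_indic ?setIT//; exact: integrable_indic.
Qed.

Lemma expectation_step i : (1 <= i)%N -> ('E_Pr[Gam i] = (gamma i * p i)%:E)%E.
Proof.
move=> i1; rewrite unlock step_indic//.
by rewrite integral_scaled_indic// update_prob.
Qed.

Lemma expectation_step_sqr i : (1 <= i)%N ->
  ('E_Pr[fun o => (Gam i o ^+ 2)%R] = (gamma i ^+ 2 * p i)%:E)%E.
Proof.
move=> i1; rewrite unlock step_indic//.
rewrite (eq_integral (fun o =>
  (gamma i ^+ 2 * \1_(U i @^-1` update_set i) o)%:E)).
  by rewrite integral_scaled_indic// update_prob.
by move=> o _; rewrite exprMn !indicE; case: (_ \in _); rewrite ?expr1n ?expr0n.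
Qed.

Lemma expectation_step_mul i : (1 <= i)%N ->
  ('E_Pr[fun o => (Gam i.+1 o * Gam i o)%R]
   = (gamma i.+1 * gamma i * (p i.+1 * p i))%:E)%E.
Proof.
move=> i1; rewrite unlock !step_indic//.
rewrite (eq_integral (fun o => (gamma i.+1 * gamma i *
  \1_(U i.+1 @^-1` update_set i.+1 `&` U i @^-1` update_set i) o)%:E)).
  rewrite integral_scaled_indic//; last exact: measurableI.
  have := U_indep (s := [:: i.+1; i]) (B := update_set).
  rewrite !big_cons big_nil mulr1 !update_prob//= => h; rewrite [RHS]EFinM -h//.
  - congr (_ * Pr _)%E; rewrite eqEsubset; split=> o /=.
      by move=> [h1 h2] j; rewrite /= !inE => /orP[] /eqP ->.
    by move=> Uo; split; apply: Uo; rewrite /= !inE eqxx ?orbT.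
  - by rewrite !inE andbT gtn_eqF.
  - by rewrite !inE /= ltn_eqF.
  - exact: measurable_update_set.
by move=> o _; rewrite indicI/= mulrACA.
Qed.

Lemma expectation_step_sub i : (1 <= i)%N ->
  ('E_Pr[fun o => (Gam i.+1 o - Gam i o)%R]
   = (gamma i.+1 * p i.+1 - gamma i * p i)%:E)%E.
Proof.
move=> i1.
have Gint j : (1 <= j)%N -> Pr.-integrable [set: W] (EFin \o Gam j).
  move=> j1; rewrite step_indic//.
  have -> : EFin \o (fun o => gamma j * \1_(U j @^-1` update_set j) o)
      = (fun o => (gamma j)%:E * (\1_(U j @^-1` update_set j) o)%:E)%E.
    by apply/funext => o; rewrite /= EFinM.
  by apply: integrableZl => //; exact: integrable_indic.
rewrite unlock integralB_EFin//; [|exact: Gint..].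
by have := expectation_step (ltn0Sn i); have := expectation_step i1;
  rewrite !unlock => -> ->; rewrite EFinB.
Qed.

End step_moments.

(** * The chain between updates and at updates *)

Section chain.
Context {R : realType} {d : nat} {dX : measure_display}
  {X : measurableType dX}.
Variables (Theta : set 'rV[R]_d) (P : 'rV[R]_d -> R.-pker X ~> X)
  (H : 'rV[R]_d -> X -> 'rV[R]_d)
  (Rs : nat -> set 'rV[R]_d) (z : sa_data R d X) (t0 : 'rV[R]_d) (x0 : X).
Variables (U : nat -> {mfun sa_space z >-> R}) (gamma p : nat -> R).
Hypothesis P_measurable : forall B : set X, measurable B ->
  trace_measurable (Theta `*` [set: X]) (fun tx => P tx.1 tx.2 B).
Hypothesis RsS : forall i, Rs i `<=` Rs i.+1.
Hypothesis hatTheta : Theta_hat Rs `<=` Theta.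
Hypothesis pr : sa_process_from P H Rs z t0 x0.
Hypothesis Rs0 : Rs 0%N t0.
Hypothesis U_uniform : forall i, (1 <= i)%N -> forall B : set R, measurable B ->
  distribution (law z) (U i) B = uniform_prob (@ltr01 R) B.
Hypothesis U_indep_past : forall i, indep_of (law z) (filtX z i) (U i.+1).
Hypothesis step_def : forall i, (1 <= i)%N -> forall o,
  step z i o = if U i o <= p i then gamma i else 0.
Hypothesis p01 : forall i, (1 <= i)%N -> 0 <= p i <= 1.

Local Notation past i := (g_sigma_algebraType (filt z i)).
Local Notation pastX i := (g_sigma_algebraType (filtX z i)).
Local Notation update i := (U i @^-1` update_set p i).
Local Open Scope ereal_scope.

(** The conditional law of the next state, as a kernel on the sample space with
    the sigma-algebra of the past. *)
Definition cond_kernel i (o : past i) : {measure set X -> \bar R} :=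
  P (theta z i o) (state z i o).

Let measurable_cond_kernel i B : measurable B ->
  measurable_fun [set: past i] (cond_kernel (i := i) ^~ B).
Proof.
move=> mB.
have m1 := measurable_kernel_along P_measurable hatTheta
  (@measurable_theta_past _ _ _ _ z i) (theta_hat_in pr Rs0 i) mB.
apply: measurableT_comp m1 (measurable_fun_pair _ (@measurable_state_past _ _ _ _ z i)).
exact: measurable_id.
Qed.

HB.instance Definition _ i :=
  isKernel.Build _ _ _ _ R (@cond_kernel i) (@measurable_cond_kernel i).

Let cond_kernel_prob i o : @cond_kernel i o [set: X] = 1.
Proof. exact: prob_kernel. Qed.

HB.instance Definition _ i :=
  Kernel_isProbability.Build _ _ _ _ R (@cond_kernel i) (@cond_kernel_prob i).

Lemma integral_next_state i (f : past i * X -> \bar R) :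
  (forall u, 0 <= f u) -> measurable_fun [set: past i * X] f ->
  \int[law z]_o f (o, state z i.+1 o)
  = \int[law z]_o \int[P (theta z i o) (state z i o)]_y f (o, y).
Proof.
move=> f0 mf.
apply: (disintegration (kap := @cond_kernel i) (@measurable_id_past _ _ _ _ z i)
  (Y := state z i.+1) _ _ f0 mf) => [//|A B mA mB].
exact: (sa_transition pr (measurable_past mA) mB).
Qed.

Let indep_event i (A : set (pastX i)) (B : set R) :
  measurable A -> measurable B ->
  law z (id @^-1` A `&` U i.+1 @^-1` B) = law z (id @^-1` A) * law z (U i.+1 @^-1` B).
Proof. by move=> mA mB; exact: U_indep_past (measurable_pastX mA) mB. Qed.

Let update_law i : law z (update i.+1) = (p i.+1)%:E.
Proof. exact: (update_prob U_uniform p01 (ltn0Sn i)). Qed.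

Lemma integral_update i (f : pastX i -> \bar R) :
  (forall o, 0 <= f o) -> measurable_fun [set: pastX i] f ->
  \int[law z]_(o in update i.+1) f o = (p i.+1)%:E * \int[law z]_o f o.
Proof.
move=> f0 mf; rewrite -update_law.
exact: (ge0_integral_indep (@measurable_id_pastX _ _ _ _ z i) (@indep_event i)
  (measurable_update_set p i.+1) f0 mf).
Qed.

Lemma integral_no_update i (f : pastX i -> \bar R) :
  (forall o, 0 <= f o) -> measurable_fun [set: pastX i] f ->
  \int[law z]_(o in ~` update i.+1) f o
  = (1 - p i.+1)%:E * \int[law z]_o f o.
Proof.
move=> f0 mf.
have mu : measurable (update i.+1).
  by apply: measurable_funPTI; exact: measurable_update_set.
have <- : law z (~` update i.+1) = (1 - p i.+1)%:E.
  by rewrite probability_setC// update_law.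
exact: (ge0_integral_indep (@measurable_id_pastX _ _ _ _ z i) (@indep_event i)
  (measurableC (measurable_update_set p i.+1)) f0 mf).
Qed.

Lemma step_no_update i o : ~ update i.+1 o -> step z i.+1 o = 0%R.
Proof.
by move=> nu; rewrite step_def//; case: ifP => // Up; exfalso; apply: nu.
Qed.

Lemma theta_no_update i o : ~ update i.+1 o -> theta z i.+1 o = theta z i o.
Proof. by move=> /step_no_update; exact: (theta_still RsS pr Rs0). Qed.

Section potential.
Variable V : X -> R.
Hypothesis mV : measurable_fun [set: X] V.
Hypothesis V1 : forall x, (1 <= V x)%R.

Let V0 x : 0 <= (V x)%:E.
Proof. by rewrite lee_fin (le_trans ler01). Qed.

Let mVs i : measurable_fun [set: sa_space z] (fun o => (V (state z i o))%:E).
Proof. by apply/measurable_EFinP; exact: measurableT_comp mV _. Qed.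

Let affine_le i (C K a : R) : (0 <= C)%R -> (0 <= K)%R ->
  'E_(law z)[V \o state z i] <= a%:E ->
  \int[law z]_o (C + K * V (state z i o))%:E <= (C + K * a)%:E.
Proof.
move=> C_0 K_0; rewrite unlock => Va.
have KV0 o : 0 <= K%:E * (V (state z i o))%:E by rewrite mule_ge0.
under eq_integral do rewrite EFinD EFinM.
rewrite ge0_integralD//; first last.
  exact: emeasurable_funM.
rewrite integral_cst// [X in C%:E * X](probability_setT (law z)) mule1 ge0_integralZl//.
by rewrite EFinD EFinM leeD2l// lee_wpmul2l.
Qed.

(** [D] is carried by the update event, which is independent of the state and
    has probability [p i.+1]; the moment of order [e] is controlled by the first
    one because [y^e] is concave. *)
Lemma expectation_jump i (D : sa_space z -> R) (K a e : R) :
  (0 <= e <= 1)%R -> (0 < a)%R -> (0 <= K)%R ->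
  measurable_fun [set: sa_space z] D ->
  (forall o, 0 <= D o)%R -> (forall o, ~ update i.+1 o -> D o = 0%R) ->
  (forall o, D o <= K * V (state z i.+1 o) `^ e)%R ->
  'E_(law z)[V \o state z i.+1] <= a%:E ->
  'E_(law z)[D] <= (p i.+1 * (K * a `^ e))%:E.
Proof.
move=> /andP[e0 e1] a0 K0 mD D0 Dnu DK Va.
pose C := (K * a `^ e * (1 - e))%R; pose K' := (K * a `^ e * (e / a))%R.
have ae0 : (0 <= K * a `^ e)%R by rewrite mulr_ge0// powR_ge0.
have C_0 : (0 <= C)%R by rewrite mulr_ge0// subr_ge0.
have K'_0 : (0 <= K')%R by rewrite mulr_ge0// divr_ge0// ltW.
have /andP[p0 p1] := p01 (ltn0Sn i).
pose F o := (C + K' * V (state z i.+1 o))%:E.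
have F0 o : 0 <= F o by rewrite lee_fin addr_ge0// mulr_ge0// (le_trans ler01).
have mF : measurable_fun [set: pastX i] F.
  apply/measurable_EFinP; apply: measurable_funD => //.
  apply: measurable_funM => //; apply: measurableT_comp mV _.
  exact: measurable_state_pastX.
have mF' : measurable_fun [set: sa_space z] F.
  apply/measurable_EFinP; apply: measurable_funD => //.
  apply: measurable_funM => //; exact: measurableT_comp mV _.
have mu : measurable (update i.+1).
  by apply: measurable_funPTI; exact: measurable_update_set.
have DF o : (D o <= C + K' * V (state z i.+1 o))%R.
  apply: (le_trans (DK o)); set y := V _.
  have y0 : (0 <= y)%R by rewrite (le_trans ler01) ?V1.
  have := @powR_le_tangent R e (y / a); rewrite e0 e1 divr_ge0 ?(ltW a0)//.
  move=> /(_ isT isT) h.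
  have -> : (C + K' * y = K * a `^ e * (1 - e + e * (y / a)))%R.
    by rewrite /C /K'; ring.
  have -> : (y = a * (y / a) :> R)%R by rewrite mulrC divfK// gt_eqF.
  rewrite powRM ?(ltW a0) ?divr_ge0 ?(ltW a0)// mulrA [(a * _ / a)%R]mulrC mulKf ?gt_eqF//.
  by rewrite ler_wpM2l.
apply: (@le_trans _ _ (\int[law z]_(o in update i.+1) F o)).
  rewrite unlock [leRHS]integral_mkcond; apply: ge0_le_integral => //.
  - by move=> o _; rewrite lee_fin.
  - exact/measurable_EFinP.
  - by apply: (measurable_restrictT _ mu).1; exact: measurable_funTS mF'.
  - move=> o _; rewrite patchE; case: ifPn => [_|nu]; first by rewrite lee_fin.
    by rewrite Dnu//; move: nu => /negP; rewrite inE.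
rewrite integral_update// EFinM lee_wpmul2l//.
apply: (le_trans (affine_le C_0 K'_0 Va)); rewrite lee_fin /C /K'.
by rewrite -[(_ * (e / a) * a)%R]mulrA divfK ?gt_eqF// -mulrDr subrK mulr1.
Qed.

Definition kpotential k (t : 'rV[R]_d) (y : X) : \bar R :=
  \int[kpow (P t) k y]_w (V w)%:E.

Lemma measurable_kpotential k dT (T : measurableType dT) (tau : T -> 'rV[R]_d) :
  measurable_fun [set: T] tau -> (forall o, Theta_hat Rs (tau o)) ->
  measurable_fun [set: T * X] (fun oy => kpotential k (tau oy.1) oy.2).
Proof.
move=> mtau tau_in.
apply: (measurable_joint_kpow (Q := fun o => P (tau o))
  (measurable_kernel_along P_measurable hatTheta mtau tau_in) k
  (F := fun oy => (V oy.2)%:E)) => //.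
by apply/measurable_EFinP; exact: measurableT_comp mV _.
Qed.

Lemma kpotential_ge0 k t y : 0 <= kpotential k t y.
Proof. exact: integral_ge0. Qed.

Let pot n k := \int[law z]_o kpotential k (theta z n o) (state z n o).

(** Averaging over the next state under the current kernel adds one step. *)
Let next_pot n k :
  \int[law z]_o kpotential k (theta z n o) (state z n.+1 o) = pot n k.+1.
Proof.
rewrite (integral_next_state (f := fun u => kpotential k (theta z n u.1) u.2)).
- apply: eq_integral => o _; rewrite /kpotential ge0_integral_kpowS//.
  exact/measurable_EFinP.
- by move=> u; exact: kpotential_ge0.
- exact: measurable_kpotential (@measurable_theta_past _ _ _ _ z n)
    (theta_hat_in pr Rs0 n).
Qed.

Let pot0 n : pot n 0 = 'E_(law z)[V \o state z n].
Proof.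
rewrite unlock; apply: eq_integral => o _; rewrite /kpotential.
by rewrite ge0_integral_kpow0//; exact/measurable_EFinP.
Qed.

Let pot1 n : 'E_(law z)[V \o state z n.+1] = pot n 1.
Proof.
rewrite -next_pot unlock; apply: eq_integral => o _; rewrite /kpotential.
by rewrite ge0_integral_kpow0//; exact/measurable_EFinP.
Qed.

Variables (C0 c1 : R) (del : nat -> R).
Hypotheses (C00 : (0 <= C0)%R) (c10 : (0 <= c1)%R).
Hypothesis del01 : forall i, (0 < del i <= 1)%R.
Hypothesis delS : forall i, (del i.+1 <= del i)%R.
Hypothesis pot_le : forall i t y k, Rs i t ->
  kpotential k t y <= (C0 + c1 * (1 - del i) ^+ k * V y)%:E.

Let K_ge0 n k : (0 <= c1 * (1 - del n) ^+ k)%R.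
Proof.
by have /andP[d0 d1] := del01 n; rewrite mulr_ge0// exprn_ge0// subr_ge0.
Qed.

Let mpot k n m : measurable_fun [set: sa_space z]
  (fun o => kpotential k (theta z n o) (state z m o)).
Proof.
have mt : measurable_fun [set: sa_space z] (theta z n) by exact: measurable_funP.
have ms : measurable_fun [set: sa_space z] (fun o => (o, state z m o)).
  by apply: measurable_fun_pair; [exact: measurable_id|exact: measurable_funP].
exact: measurableT_comp (measurable_kpotential k mt (theta_hat_in pr Rs0 n)) ms.
Qed.

Let pot_bound n k (a : R) : 'E_(law z)[V \o state z n] <= a%:E ->
  pot n k <= (C0 + c1 * (1 - del n) ^+ k * a)%:E.
Proof.
move=> Va; apply: le_trans (affine_le C00 (K_ge0 n k) Va).
apply: ge0_le_integral => //.
- by move=> o _; exact: kpotential_ge0.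
- apply/measurable_EFinP; apply: measurable_funD => //.
  apply: measurable_funM => //; exact: measurableT_comp mV _.
- by move=> o _; apply: pot_le; exact: (theta_in pr Rs0).
Qed.

(** Without an update the parameter is kept, and [next_pot] applies; after an
    update only the bound [pot_le] at the new parameter is available. *)
Let pot_rec n k (a b : R) :
  pot n k.+1 <= b%:E -> 'E_(law z)[V \o state z n.+1] <= a%:E ->
  pot n.+1 k <= ((1 - p n.+1) * b
    + p n.+1 * (C0 + c1 * (1 - del n.+1) ^+ k * a))%:E.
Proof.
move=> pb Va; have /andP[p0 p1] := p01 (ltn0Sn n).
have mu : measurable (update n.+1).
  by apply: measurable_funPTI; exact: measurable_update_set.
have mkp := mpot k n.+1 n.+1.
rewrite /pot -(setUv (update n.+1)) ge0_integral_setU//; first last.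
- by rewrite disj_set2E setICr.
- by move=> o _; exact: kpotential_ge0.
- by rewrite setUv.
- exact: measurableC.
rewrite addeC EFinD; apply: leeD.
- rewrite (eq_integral (fun o => kpotential k (theta z n o) (state z n.+1 o))).
    rewrite (integral_no_update (f := fun o =>
      kpotential k (theta z n o) (state z n.+1 o))).
    + by rewrite next_pot EFinM lee_wpmul2l// lee_fin subr_ge0.
    + by move=> o; exact: kpotential_ge0.
    + have ms : measurable_fun [set: pastX n] (fun o => (o, state z n.+1 o)).
        by apply: measurable_fun_pair; [exact: measurable_id|
          exact: (@measurable_state_pastX _ _ _ _ z n)].
      exact: measurableT_comp (measurable_kpotential k
        (@measurable_theta_pastX _ _ _ _ z n) (theta_hat_in pr Rs0 n)) ms.
  by move=> o; rewrite inE => nu; rewrite theta_no_update.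
- pose F o := (C0 + c1 * (1 - del n.+1) ^+ k * V (state z n.+1 o))%:E.
  have F0 o : 0 <= F o.
    by rewrite lee_fin addr_ge0// mulr_ge0// (le_trans ler01).
  apply: (@le_trans _ _ (\int[law z]_(o in update n.+1) F o)).
    apply: ge0_le_integral => //.
    + by move=> o _; exact: kpotential_ge0.
    + exact: measurable_funTS.
    + apply: measurable_funTS; apply/measurable_EFinP.
      apply: measurable_funD => //.
      apply: measurable_funM => //; exact: measurableT_comp mV _.
    + by move=> o _; apply: pot_le; exact: (theta_in pr Rs0).
  rewrite (integral_update (f := F))//; last first.
    apply/measurable_EFinP; apply: measurable_funD => //.
    apply: measurable_funM => //; apply: measurableT_comp mV _.
    exact: measurable_state_pastX.
  rewrite EFinM lee_wpmul2l//.
  exact: affine_le.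
Qed.

(** Between updates the kernel is constant and pulls [V] back to the level [C0]
    at rate [1 - del]; an update restarts this decay with a factor [c1].  So [V]
    stays bounded in mean once updates are rare on the scale [1 / del] of
    mixing.  The induction needs all [k] at once: it shows that
    [E P_(theta_n)^k V(X_n) <= C0 + L (1 - del n)^k]. *)
Lemma rare_updates_bound N (A : R) : (0 <= A)%R ->
  (forall n, (N <= n)%N -> 2 * c1 * p n.+1 <= del n)%R ->
  'E_(law z)[V \o state z N] <= A%:E ->
  forall n, (N <= n)%N ->
    'E_(law z)[V \o state z n] <= (C0 + Num.max C0 (c1 * A))%:E.
Proof.
move=> A0 pdel VN; set L := Num.max _ _.
have LC0 : (C0 <= L)%R by rewrite /L le_max lexx.
have LcA : (c1 * A <= L)%R by rewrite /L le_max lexx orbT.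
have main n : (N <= n)%N -> forall k,
    pot n k <= (C0 + L * (1 - del n) ^+ k)%:E.
  move=> Nn; rewrite -(subnK Nn); elim: (n - N)%N => [|m IHm] k.
    rewrite add0n (le_trans (pot_bound _ VN))// lee_fin lerD2l.
    have /andP[d0 d1] := del01 N.
    by rewrite mulrAC ler_wpM2r// exprn_ge0// subr_ge0.
  rewrite addSn; set l := (m + N)%N in IHm *.
  have V1l : 'E_(law z)[V \o state z l.+1] <= (C0 + L * (1 - del l))%:E.
    by rewrite pot1 (le_trans (IHm 1%N))// expr1.
  apply: (le_trans (pot_rec (IHm k.+1) V1l)); rewrite lee_fin.
  have /andP[d0 d1] := del01 l; have /andP[d0' d1'] := del01 l.+1.
  have pd : (2 * c1 * p l.+1 <= del l)%R by apply: pdel; rewrite /l leq_addl.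
  have /andP[p0 p1] := p01 (ltn0Sn l).
  have qq' : ((1 - del l) ^+ k <= (1 - del l.+1) ^+ k)%R.
    by rewrite lerXn2r ?nnegrE ?subr_ge0// lerB// delS.
  have q'0 : (0 <= (1 - del l.+1) ^+ k)%R by rewrite exprn_ge0// subr_ge0.
  have q0 : (0 <= (1 - del l) ^+ k)%R by rewrite exprn_ge0// subr_ge0.
  rewrite exprS.
  move: qq' q'0 q0; set q := (_ ^+ k)%R; set q' := (_ ^+ k)%R => qq' q'0 q0.
  set s := (1 - del l)%R; set P0 := p l.+1 in p0 p1 pd *.
  have s0 : (0 <= s)%R by rewrite subr_ge0.
  have s1 : (s <= 1)%R by rewrite gerBl ltW.
  have L0 : (0 <= L)%R by exact: le_trans LC0.
  have h1 : (L * (s * q) <= L * s * q')%R by rewrite -mulrA !ler_wpM2l.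
  have h2 : (P0 * (c1 * (C0 + L * s)) <= 2 * c1 * P0 * L)%R.
    have : (C0 + L * s <= 2 * L)%R.
      by rewrite mulr_natl mulr2n lerD// ler_piMr.
    move=> /(ler_wpM2l (mulr_ge0 p0 c10)); lra.
  have h3 : (2 * c1 * P0 * L <= del l * L)%R by rewrite ler_wpM2r.
  have h4 : ((1 - P0) * (L * s) <= L - del l * L)%R.
    have -> : (L - del l * L = L * s)%R by rewrite /s; ring.
    by rewrite ler_piMl ?mulr_ge0// gerBl.
  have h5 : ((1 - P0) * (L * s) + P0 * (c1 * (C0 + L * s)) <= L)%R by lra.
  have h6 : ((1 - P0) * (L * (s * q)) <= (1 - P0) * (L * s * q'))%R.
    by rewrite ler_wpM2l// subr_ge0.
  have := ler_wpM2r q'0 h5; lra.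
by move=> n Nn; rewrite -pot0 (le_trans (main n Nn 0%N))// expr0 mulr1.
Qed.

End potential.

End chain.

(** * Uniform moments when the ergodicity constant is uniform *)

Section uniform_moment.
Context {R : realType} {d : nat} {dX : measure_display}
  {X : measurableType dX}.
Variables (Theta : set 'rV[R]_d) (P : 'rV[R]_d -> R.-pker X ~> X)
  (pi : 'rV[R]_d -> probability X R) (H : 'rV[R]_d -> X -> 'rV[R]_d)
  (Rs : nat -> set 'rV[R]_d) (z : sa_data R d X) (t0 : 'rV[R]_d) (x0 : X).
Variables (U : nat -> {mfun sa_space z >-> R}) (gamma p xi : nat -> R)
  (V : X -> R) (alpha_rho : R).
Hypothesis P_measurable : forall B : set X, measurable B ->
  trace_measurable (Theta `*` [set: X]) (fun tx => P tx.1 tx.2 B).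
Hypothesis RsS : forall i, Rs i `<=` Rs i.+1.
Hypothesis hatTheta : Theta_hat Rs `<=` Theta.
Hypothesis pr : sa_process_from P H Rs z t0 x0.
Hypothesis Rs0 : Rs 0%N t0.
Hypothesis U_uniform : forall i, (1 <= i)%N -> forall B : set R, measurable B ->
  distribution (law z) (U i) B = uniform_prob (@ltr01 R) B.
Hypothesis U_indep_past : forall i, indep_of (law z) (filtX z i) (U i.+1).
Hypothesis step_def : forall i, (1 <= i)%N -> forall o,
  step z i o = if U i o <= p i then gamma i else 0.
Hypothesis p01 : forall i, (1 <= i)%N -> 0 <= p i <= 1.
Hypothesis xi1 : forall i, 1 <= xi i.
Hypothesis xiS : forall i, xi i <= xi i.+1.
Hypothesis mV : measurable_fun [set: X] V.
Hypothesis V1 : forall x, 1 <= V x.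

Hypothesis alpha_rho0 : 0 <= alpha_rho.

(** Ergodicity is applied to [V] in every coordinate with [r = 1].  Its case
    [k = 0] at the starting point bounds [pi_t(V)] by a multiple of [V x0],
    uniformly in [t]. *)
Lemma kpotential_le (M rho m : R) i t k y :
  'I_d -> 1 <= m -> M <= m -> 0 <= rho ->
  (1 - rho)^-1 <= m * xi i `^ alpha_rho -> 0 <= M -> rho < 1 ->
  (forall f : X -> 'rV[R]_d, measurable_fun [set: X] f ->
    (Vnorm V 1 f < +oo)%E -> vintegrable (pi t) f /\
    forall k x, vintegrable (kpow (P t) k x) f /\
      enorm (vintegral (kpow (P t) k x) f - vintegral (pi t) f) <=
      V x `^ 1 * fine (Vnorm V 1 f) * M * rho ^+ k) ->
  (kpotential P V k t y <= ((1 + d%:R * m) * V x0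
     + d%:R * m * (1 - (m * xi i `^ alpha_rho)^-1) ^+ k * V y)%:E)%E.
Proof.
move=> j m1 Mm rho0 rhoxi M0 rho1 Gt.
pose f x : 'rV[R]_d := const_mx (V x).
have mf : measurable_fun [set: X] f.
  by apply: measurable_rowP => i'; under eq_fun do rewrite mxE.
have V_0 x : 0 <= V x by rewrite (le_trans ler01).
have [foo fle] : (Vnorm V 1 f < +oo)%E /\ fine (Vnorm V 1 f) <= d%:R.
  apply: Vnorm_le_bound => // x'; apply: enorm_le_bound => i'.
  by rewrite mxE powRr1// ger0_norm.
have [_ Gf] := Gt f mf foo.
have fint l x : (kpow (P t) l x).-integrable [set: X] (EFin \o V).
  by have := (Gf l x).1 j; under eq_fun do rewrite mxE.
pose mu := \int[pi t]_y V y.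
have m0 : 0 <= m by exact: le_trans m1.
have fine0 : 0 <= fine (Vnorm V 1 f).
  apply: fine_ge0; apply: ereal_sup_ge; exists (enorm (f x0) / V x0 `^ 1)%:E.
    by exists x0.
  by rewrite lee_fin divr_ge0 ?enorm_ge0// powR_ge0.
have Gj l x : `|\int[kpow (P t) l x]_y V y - mu| <= d%:R * m * rho ^+ l * V x.
  have := le_trans (coord_le_enorm _ j) (Gf l x).2; rewrite !mxE.
  under eq_Rintegral do rewrite mxE.
  under [X in _ - X]eq_Rintegral do rewrite mxE.
  move=> h; apply: (le_trans h); rewrite powRr1//.
  have -> : V x * fine (Vnorm V 1 f) * M * rho ^+ l
      = fine (Vnorm V 1 f) * M * (rho ^+ l * V x) by ring.
  rewrite -[leRHS]mulrA ler_wpM2r ?mulr_ge0 ?exprn_ge0//.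
  exact: ler_pM.
have muV : mu <= (1 + d%:R * m) * V x0.
  have := Gj 0%N x0; rewrite Rintegral_kpow0// expr0 mulr1 ler_norml.
  by move=> /andP[h _]; lra.
have -> : kpotential P V k t y = (\int[kpow (P t) k y]_w V w)%:E.
  by rewrite /kpotential /Rintegral fineK// integrable_fin_num.
rewrite lee_fin.
have h : \int[kpow (P t) k y]_w V w <= mu + d%:R * m * rho ^+ k * V y.
  by have := Gj k y; rewrite ler_norml => /andP[_ h]; lra.
apply: (le_trans h); apply: lerD => //; rewrite ler_wpM2r// ler_wpM2l ?mulr_ge0//.
have w1 : 1 <= m * xi i `^ alpha_rho.
  by rewrite -[leLHS]mulr1 ler_pM// powR_ge1.
have w0 : 0 < m * xi i `^ alpha_rho by rewrite (lt_le_trans ltr01).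
have rw : rho <= 1 - (m * xi i `^ alpha_rho)^-1.
  have r0 : 0 < 1 - rho by rewrite subr_gt0.
  have : (m * xi i `^ alpha_rho)^-1 <= 1 - rho.
    by rewrite -[leRHS]invrK lef_pV2// posrE ?invr_gt0.
  lra.
by rewrite lerXn2r ?nnegrE// (le_trans rho0).
Qed.

Lemma uniform_moment (m c alpha_V : R) (N : nat) :
  'I_d -> 1 <= m -> 0 <= c -> 0 <= alpha_V ->
  (forall i t, Rs i t -> exists M rho : R,
    [/\ [/\ 0 <= M, M <= m, 0 <= rho, rho < 1 &
         (1 - rho)^-1 <= m * xi i `^ alpha_rho] &
    forall f : X -> 'rV[R]_d, measurable_fun [set: X] f ->
    (Vnorm V 1 f < +oo)%E -> vintegrable (pi t) f /\
    forall k x, vintegrable (kpow (P t) k x) f /\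
      enorm (vintegral (kpow (P t) k x) f - vintegral (pi t) f) <=
      V x `^ 1 * fine (Vnorm V 1 f) * M * rho ^+ k]) ->
  (forall i, ('E_(law z)[V \o state z i]
      <= (c * xi i `^ alpha_V * V x0)%:E)%E) ->
  (forall n, (N <= n)%N ->
    2 * (d%:R * m) * p n.+1 <= (m * xi n `^ alpha_rho)^-1) ->
  forall i, ('E_(law z)[V \o state z i]
    <= ((2 * (1 + d%:R * m) + (1 + d%:R * m) * (c * xi N `^ alpha_V))
        * V x0)%:E)%E.
Proof.
move=> j m1 c0 aV0 erg VE HN i.
have m_gt0 : 0 < m by rewrite (lt_le_trans ltr01).
have w1 n : 1 <= m * xi n `^ alpha_rho.
  by rewrite -[leLHS]mulr1 ler_pM// powR_ge1.
have w0 n : 0 < m * xi n `^ alpha_rho by rewrite (lt_le_trans ltr01).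
have xiM k n : (k <= n)%N -> xi k <= xi n.
  by apply: (homo_leq (r := <=%R)) => //; exact: le_trans.
have xi0 n : 0 <= xi n by rewrite (le_trans ler01).
have Vx0 : 0 <= V x0 by rewrite (le_trans ler01).
set c1 := d%:R * m; have c1_0 : 0 <= c1 by rewrite mulr_ge0// ltW.
set A := c * xi N `^ alpha_V.
have A0 : 0 <= A by rewrite mulr_ge0// powR_ge0.
have C0_0 : 0 <= (1 + c1) * V x0 by rewrite mulr_ge0// addr_ge0.
have [iN|Ni] := ltnP i N.
  apply: (le_trans (VE i)); rewrite lee_fin ler_wpM2r//.
  have : c * xi i `^ alpha_V <= A.
    by rewrite ler_wpM2l// ler_powR_base// xiM// ltnW.
  have := mulr_ge0 c1_0 A0; lra.
have del01 n : 0 < (m * xi n `^ alpha_rho)^-1 <= 1.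
  by rewrite invr_gt0 w0/= invf_le1.
have delS n : (m * xi n.+1 `^ alpha_rho)^-1 <= (m * xi n `^ alpha_rho)^-1.
  by rewrite lef_pV2 ?posrE// ler_wpM2l ?(ltW m_gt0)// ler_powR_base.
have pot_le n t y k : Rs n t -> (kpotential P V k t y <= ((1 + c1) * V x0
    + c1 * (1 - (m * xi n `^ alpha_rho)^-1) ^+ k * V y)%:E)%E.
  move=> /erg[M [rho [[M0 Mm r0 r1 rxi] Gt]]].
  exact: (kpotential_le k y j m1 Mm r0 rxi M0 r1 Gt).
apply: (le_trans (rare_updates_bound P_measurable RsS hatTheta pr Rs0 U_uniform
  U_indep_past step_def p01 mV V1 C0_0 c1_0 del01 delS pot_le
  (mulr_ge0 A0 Vx0) HN (VE N) Ni)).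
rewrite lee_fin.
have : Num.max ((1 + c1) * V x0) (c1 * (A * V x0))
    <= (1 + c1) * V x0 + c1 * (A * V x0).
  rewrite ge_max; apply/andP; split; first by rewrite lerDl (mulr_ge0 c1_0 (mulr_ge0 A0 Vx0)).
  by rewrite lerDr.
have := mulr_ge0 A0 Vx0.
lra.
Qed.

End uniform_moment.

(** The mixing time at stage [n] is of order [xi_n^alpha_rho], and the summability
    hypothesis forces [p_n xi_n^alpha_rho] to vanish: this is where
    [eta_gamma + eta_p <= 1] enters, through [b - 1 <= eta_p]. *)
Lemma uniform_moment_condG (R : realType) (d : nat) (dX : measure_display)
  (X : measurableType dX)
  (Theta : set 'rV[R]_d) (P : 'rV[R]_d -> R.-pker X ~> X)
  (pi : 'rV[R]_d -> probability X R) (H : 'rV[R]_d -> X -> 'rV[R]_d)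
  (Rs : nat -> set 'rV[R]_d) (Z : 'rV[R]_d -> X -> sa_data R d X)
  (xi : nat -> R) (U : forall t x, nat -> {mfun sa_space (Z t x) >-> R})
  (gamma p : nat -> R) (c_p eta_gamma eta_p s : R)
  (V : X -> R) (c alpha_V alpha_rho : R)
  (P_measurable : forall B : set X, measurable B ->
     trace_measurable (Theta `*` [set: X]) (fun tx => P tx.1 tx.2 B))
  (RsS : forall i, Rs i `<=` Rs i.+1) (hatTheta : Theta_hat Rs `<=` Theta)
  (xi1 : forall i, 1 <= xi i) (xiS : forall i, xi i <= xi i.+1)
  (Z_process : forall t x, Rs 0%N t -> sa_process_from P H Rs (Z t x) t x)
  (U_uniform : forall t x, Rs 0%N t -> forall i, (1 <= i)%N ->
     forall B : set R, measurable B ->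
       distribution (law (Z t x)) (U t x i) B = uniform_prob (@ltr01 R) B)
  (U_indep_past : forall t x, Rs 0%N t -> forall i,
     indep_of (law (Z t x)) (filtX (Z t x) i) (U t x i.+1))
  (step_def : forall t x, Rs 0%N t -> forall i, (1 <= i)%N ->
     forall o, step (Z t x) i o = if U t x i o <= p i then gamma i else 0)
  (p_def : forall i, (1 <= i)%N ->
     0 <= p i <= 1 /\ p i = c_p * i%:R `^ (- eta_p))
  (c_p_gt0 : 0 < c_p) (eta0 : 0 <= eta_gamma + 2 * eta_p)
  (eta_le1 : eta_gamma + eta_p <= 1)
  (V_measurable : measurable_fun [set: X] V) (V_ge1 : forall x, 1 <= V x)
  (c0 : 0 <= c) (alpha_V_ge0 : 0 <= alpha_V)
  (V_bound : forall t x, Rs 0%N t -> forall i,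
     ('E_(law (Z t x))[V \o state (Z t x) i]
      <= (c * xi i `^ alpha_V * V x)%:E)%E)
  (G : condG P pi Rs xi V 0 alpha_rho) (s_ge : alpha_rho <= s)
  (sum1 : (\sum_(1 <= i <oo)
     (i%:R `^ (- eta_gamma - 2 * eta_p) * xi i `^ s)%:E < +oo)%E) :
  'I_d ->
  exists2 C, 0 <= C & forall t x, Rs 0%N t -> forall i,
    ('E_(law (Z t x))[V \o state (Z t x) i] <= (C * V x)%:E)%E.
Proof.
move=> j; have [_ ar0 /(_ 1)] := G; rewrite ltr01 lexx => /(_ isT).
move=> [M [rho [c_r [cr0 Mrho Gt Mbd]]]].
pose m := Num.max c_r 1.
have m1 : 1 <= m by rewrite /m le_max lexx orbT.
have crm : c_r <= m by rewrite /m le_max lexx.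
have m_gt0 : 0 < m by rewrite (lt_le_trans ltr01).
have d0 : 0 < d%:R :> R by rewrite ltr0n; case: (d) j => // -[].
pose K := 2 * (d%:R * m) * c_p * m.
have K0 : 0 < K by rewrite !mulr_gt0.
have b1 : eta_gamma + 2 * eta_p - 1 <= eta_p by lra.
have al : 0 <= alpha_rho <= s by rewrite ar0.
have bE : - eta_gamma - 2 * eta_p = - (eta_gamma + 2 * eta_p) by ring.
have Kinv0 : 0 < K^-1 by rewrite invr_gt0.
rewrite bE in sum1.
have [N HN] := summable_powR_vanish xi1 xiS eta0 b1 al sum1 Kinv0.
pose A := c * xi N `^ alpha_V.
have A0 : 0 <= A by rewrite mulr_ge0// powR_ge0.
exists (2 * (1 + d%:R * m) + (1 + d%:R * m) * A).
  have dm0 : 0 <= 1 + d%:R * m by rewrite addr_ge0// mulr_ge0// ltW.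
  by rewrite addr_ge0// mulr_ge0.
move=> t x Rt.
apply: (uniform_moment P_measurable RsS hatTheta (Z_process t x Rt) Rt
  (U_uniform t x Rt) (U_indep_past t x Rt) (step_def t x Rt)
  (fun i i1 => (p_def i i1).1) xi1 xiS V_measurable V_ge1 ar0 j m1 c0
  alpha_V_ge0 _ (V_bound t x Rt) _) => [i t' Rt'|n Nn].
- have ht : Theta_hat Rs t' by exists i.
  have [MM /andP[r0 r1]] := Mrho t' ht; have [Mle rle] := Mbd i t' Rt'.
  exists (M t'), (rho t'); split; last exact: Gt.
  split=> //; last 2 first.
  + exact: ltW.
  + by rewrite (le_trans rle)// ler_wpM2r ?powR_ge0.
  + by rewrite (le_trans Mle)// powRr0 mulr1.
- have [_ ->] := p_def n.+1 isT.
  rewrite -[leRHS]mul1r ler_pdivlMr ?mulr_gt0 ?powR_gt0 ?(lt_le_trans ltr01 (xi1 n))//.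
  have := HN n.+1 (leqW Nn).
  have : n.+1%:R `^ (- eta_p) * xi n `^ alpha_rho
      <= n.+1%:R `^ (- eta_p) * xi n.+1 `^ alpha_rho.
    by rewrite ler_wpM2l ?powR_ge0// ler_powR_base// (le_trans ler01).
  move=> /le_trans/[apply]; rewrite -[K^-1]mul1r ler_pdivlMr// /K => h.
  apply: le_trans h; rewrite le_eqVlt; apply/orP; left; apply/eqP; ring.
Qed.

(** * Verification of the summability conditions *)

Lemma row_subE (R : realType) d (u v : 'rV[R]_d) j :
  (u - v) ord0 j = u ord0 j - v ord0 j.
Proof. by rewrite !mxE. Qed.

Lemma series_lty (R : realType) (u : nat -> \bar R) (w : nat -> R) (K : R) : 0 <= K ->
  (forall i, 0 <= w i) -> (\sum_(1 <= i <oo) (w i)%:E < +oo)%E ->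
  (forall i, (1 <= i)%N -> (0 <= u i)%E /\ (u i <= (K * w i)%:E)%E) ->
  (\sum_(1 <= i <oo) u i < +oo)%E.
Proof.
move=> K0 w0 woo uw.
pose v i := if (1 <= i)%N then u i else 0%E.
have -> : (\sum_(1 <= i <oo) u i = \sum_(1 <= i <oo) v i)%E.
  apply: congr_lim; apply/funext => n; apply: eq_big_nat => i /andP[i1 _].
  by rewrite /v i1.
apply: (@le_lt_trans _ _ (\sum_(1 <= i <oo) (K%:E * (w i)%:E))%E).
  apply: lee_nneseries => [i i1 _|i _]; rewrite /v.
    by rewrite i1; have [] := uw i i1.
  case: ifP => [/uw[_]|_]; first by rewrite EFinM.
  by rewrite mule_ge0// lee_fin.
rewrite nneseriesZl => [|i _]; last by rewrite lee_fin.
by rewrite lte_mul_pinfty// lee_fin.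
Qed.

Section verification.
Context {R : realType} {d : nat} {dX : measure_display}
  {X : measurableType dX}.
Variables (Theta : set 'rV[R]_d) (P : 'rV[R]_d -> R.-pker X ~> X)
  (pi : 'rV[R]_d -> probability X R) (H : 'rV[R]_d -> X -> 'rV[R]_d)
  (Rs : nat -> set 'rV[R]_d) (Z : 'rV[R]_d -> X -> sa_data R d X)
  (xi : nat -> R) (alpha_w : R)
  (U : forall t x, nat -> {mfun sa_space (Z t x) >-> R})
  (gamma p : nat -> R) (c_gamma c_p eta_gamma eta_p : R) (V : X -> R).
Hypothesis P_measurable : forall B : set X, measurable B ->
  trace_measurable (Theta `*` [set: X]) (fun tx => P tx.1 tx.2 B).
Hypothesis H_measurable :
  trace_measurable (Theta `*` [set: X]) (fun tx => H tx.1 tx.2).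
Hypothesis Z_process : forall t x, Rs 0%N t ->
  sa_process_from P H Rs (Z t x) t x.
Hypothesis W : condW Theta pi H Rs Z xi alpha_w.
Hypothesis alpha_w_gt0 : 0 < alpha_w.
Hypothesis U_indep : forall t x, Rs 0%N t ->
  mutually_indep (law (Z t x)) (U t x).
Hypothesis U_uniform : forall t x, Rs 0%N t -> forall i, (1 <= i)%N ->
  forall B : set R, measurable B ->
    distribution (law (Z t x)) (U t x i) B = uniform_prob (@ltr01 R) B.
Hypothesis U_indep_past : forall t x, Rs 0%N t -> forall i,
  indep_of (law (Z t x)) (filtX (Z t x) i) (U t x i.+1).
Hypothesis step_def : forall t x, Rs 0%N t -> forall i, (1 <= i)%N ->
  forall o, step (Z t x) i o = if U t x i o <= p i then gamma i else 0.
Hypothesis gamma_def : forall i, (1 <= i)%N ->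
  0 < gamma i < 1 /\ gamma i = c_gamma * i%:R `^ (- eta_gamma).
Hypothesis p_def : forall i, (1 <= i)%N ->
  0 <= p i <= 1 /\ p i = c_p * i%:R `^ (- eta_p).
Hypotheses (c_gamma_gt0 : 0 < c_gamma) (c_p_gt0 : 0 < c_p).
Hypotheses (eta_gamma01 : 0 < eta_gamma < 1) (eta_p01 : 0 < eta_p < 1).
Hypothesis eta_le1 : eta_gamma + eta_p <= 1.
Hypotheses (mV : measurable_fun [set: X] V) (V1 : forall x, 1 <= V x).

Let p01 i : (1 <= i)%N -> 0 <= p i <= 1.
Proof. by move=> /p_def[]. Qed.

Let xi1 i : 1 <= xi i.
Proof. by have [w [M0 [c [_ _ _ _ [_ _ _ []]]]]] := W. Qed.

Let xiS i : xi i <= xi i.+1.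
Proof. by have [w [M0 [c [_ _ _ _ [_ _ _ []]]]]] := W. Qed.

Let RsS i : Rs i `<=` Rs i.+1.
Proof. by have [w [M0 [c [_ _ []]]]] := W. Qed.

Let hatTheta : Theta_hat Rs `<=` Theta.
Proof. by have [w [M0 [c [_ _ []]]]] := W. Qed.

Variables (beta_H beta_g alpha_g alpha_H alpha_V S c Cg : R).
Let g t := poisson_sum (P t) (pi t) (H t).

Hypothesis gP : forall t, Theta_hat Rs t -> poisson_solution P pi H t (g t) /\
  poisson_sum_cvg (P t) (pi t) (H t).
Hypotheses (beta_H_bounds : 0 <= beta_H <= 2^-1)
  (beta_g_bounds : 0 <= beta_g <= 2^-1).
Hypotheses (alpha_g0 : 0 <= alpha_g) (alpha_H0 : 0 <= alpha_H)
  (alpha_V0 : 0 <= alpha_V).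
Hypotheses (c_gt0 : 0 < c) (Cg0 : 0 <= Cg).
Hypothesis H_bound : forall t x, Rs 0%N t -> forall i t', Rs i t' ->
  enorm (H t' x) <= c * xi i `^ alpha_H * V x `^ beta_H.
Hypothesis V_bound : forall t x, Rs 0%N t -> forall i,
  ('E_(law (Z t x))[V \o state (Z t x) i] <= (c * xi i `^ alpha_V * V x)%:E)%E.
Hypothesis g_bound : forall i t x, Rs i t ->
  enorm (g t x) + enorm (vintegral (P t x) (g t))
  <= Cg * xi i `^ alpha_g * V x `^ beta_g.
Hypothesis S_H : alpha_H + beta_H * alpha_V <= S.
Hypothesis S_g : alpha_g + beta_g * alpha_V <= S.
Hypothesis sum1 : (\sum_(1 <= i <oo)
  (i%:R `^ (- eta_gamma - 2 * eta_p) * xi i `^ (alpha_w + S))%:E < +oo)%E.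
Hypothesis sum2 : (\sum_(1 <= i <oo)
  (i%:R `^ (- 2 * eta_gamma - eta_p) * xi i `^ (2 * (alpha_w + S)))%:E < +oo)%E.

Let jump t x i (o : sa_space (Z t x)) :=
  enorm (vintegral (P (theta (Z t x) i o) (state (Z t x) i o))
           (g (theta (Z t x) i o))
         - vintegral (P (theta (Z t x) i.-1 o) (state (Z t x) i o))
           (g (theta (Z t x) i.-1 o))).

Let measurable_jump t x : Rs 0%N t -> forall i,
  measurable_fun [set: sa_space (Z t x)] (jump (t := t) (x := x) i).
Proof.
move=> Rt i; have pr := Z_process x Rt.
have mt n : measurable_fun [set: sa_space (Z t x)] (theta (Z t x) n).
  exact: measurable_funP.
have ms : measurable_fun [set: sa_space (Z t x)] (fun o => (o, state (Z t x) i o)).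
  by apply: measurable_fun_pair; [exact: measurable_id|exact: measurable_funP].
apply: measurable_enorm => j.
have mPg n : measurable_fun [set: sa_space (Z t x)] (fun o =>
    vintegral (P (theta (Z t x) n o) (state (Z t x) i o)) (g (theta (Z t x) n o)) ord0 j).
  exact: measurableT_comp (measurable_Pg_along P_measurable H_measurable
    hatTheta (mt n) (theta_hat_in pr Rt n) gP j) ms.
have -> : (fun o => (vintegral (P (theta (Z t x) i o) (state (Z t x) i o))
        (g (theta (Z t x) i o))
      - vintegral (P (theta (Z t x) i.-1 o) (state (Z t x) i o))
        (g (theta (Z t x) i.-1 o))) ord0 j)
  = (fun o => vintegral (P (theta (Z t x) i o) (state (Z t x) i o))
        (g (theta (Z t x) i o)) ord0 j
      - vintegral (P (theta (Z t x) i.-1 o) (state (Z t x) i o))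
        (g (theta (Z t x) i.-1 o)) ord0 j).
  by apply/funext => o; rewrite row_subE.
exact: measurable_funB.
Qed.

Let V_ge0 x : 0 <= V x.
Proof. exact: le_trans ler01 (V1 x). Qed.

Let xi_gt0 i : 0 < xi i.
Proof. exact: lt_le_trans ltr01 (xi1 i). Qed.

Let jump_le t x : Rs 0%N t -> forall i,
  ('E_(law (Z t x))[jump (t := t) (x := x) i.+1]
   <= (p i.+1 * (2 * d%:R * Cg * xi i.+1 `^ alpha_g
       * (c * xi i.+1 `^ alpha_V * V x) `^ beta_g))%:E)%E.
Proof.
move=> Rt i; have pr := Z_process x Rt.
have /andP[bg0 bg2] := beta_g_bounds.
have bg1 : beta_g <= 1 by lra.
apply: (expectation_jump (@U_uniform t x Rt) (@U_indep_past t x Rt) p01 mV V1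
  (a := c * xi i.+1 `^ alpha_V * V x)).
- by rewrite bg0.
- by rewrite !mulr_gt0 ?powR_gt0// (lt_le_trans ltr01).
- by rewrite !mulr_ge0// powR_ge0.
- exact: measurable_jump.
- by move=> o; exact: enorm_ge0.
- move=> o nu; rewrite /jump.
  rewrite (theta_no_update RsS pr Rt (@step_def t x Rt) nu) subrr.
  by rewrite /enorm big1 ?sqrtr0// => j _; rewrite mxE expr0n.
- move=> o; rewrite /jump.
  have b n : (n <= 1)%N -> forall j, `|vintegral (P (theta (Z t x) (i + n)%N o)
      (state (Z t x) i.+1 o)) (g (theta (Z t x) (i + n)%N o)) ord0 j|
      <= Cg * xi i.+1 `^ alpha_g * V (state (Z t x) i.+1 o) `^ beta_g.
    move=> n1 j; apply: (le_trans (coord_le_enorm _ _)).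
    have Rn : Rs i.+1 (theta (Z t x) (i + n)%N o).
      case: n n1 => [|[|//]] _; rewrite ?addn0 ?addn1.
        by apply: RsS; exact: (theta_in pr Rt).
      exact: (theta_in pr Rt).
    by apply: le_trans (g_bound _ Rn); rewrite lerDr enorm_ge0.
  have -> : 2 * d%:R * Cg * xi i.+1 `^ alpha_g * V (state (Z t x) i.+1 o) `^ beta_g
      = d%:R * (Cg * xi i.+1 `^ alpha_g * V (state (Z t x) i.+1 o) `^ beta_g
        + Cg * xi i.+1 `^ alpha_g * V (state (Z t x) i.+1 o) `^ beta_g) by ring.
  apply: enorm_le_bound => j; rewrite row_subE.
  apply: (le_trans (ler_normB _ _)); apply: lerD.
    by have := b 1%N isT j; rewrite addn1.
  by have := b 0%N isT j; rewrite addn0.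
- exact: V_bound.
Qed.

Let xi_le i (a b : R) : a <= b -> xi i `^ a <= xi i `^ b.
Proof. by move=> ab; rewrite ler_powR. Qed.

Let powRN_S i (a : R) : (1 <= i)%N -> 0 <= a ->
  i.+1%:R `^ (- a) <= i%:R `^ (- a) :> R.
Proof.
move=> i1 a0; rewrite !powRN lef_pV2 ?posrE ?powR_gt0 ?ltr0n//.
by rewrite ler_powR_base// ?ler0n// ler_nat.
Qed.

Let gamma_S i : (1 <= i)%N ->
  0 <= gamma i.+1 /\ gamma i.+1 <= c_gamma * i%:R `^ (- eta_gamma).
Proof.
move=> i1; have [/andP[/ltW g0 _] gE] := gamma_def (ltn0Sn i).
split=> //; rewrite gE ler_wpM2l ?(ltW c_gamma_gt0)// powRN_S//.
by case/andP: eta_gamma01 => /ltW.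
Qed.

Let p_S i : (1 <= i)%N -> 0 <= p i.+1 /\ p i.+1 <= c_p * i%:R `^ (- eta_p).
Proof.
move=> i1; have [/andP[p0 _] pE] := p_def (ltn0Sn i).
split=> //; rewrite pE ler_wpM2l ?(ltW c_p_gt0)// powRN_S//.
by case/andP: eta_p01 => /ltW.
Qed.

Let indep_step t x : Rs 0%N t -> forall i,
  indep_of (law (Z t x)) (filtX (Z t x) i) (step (Z t x) i.+1).
Proof.
move=> Rt i A B FA mB.
pose B' := (fun u : R => if u <= p i.+1 then gamma i.+1 else 0) @^-1` B.
have -> : step (Z t x) i.+1 @^-1` B = U t x i.+1 @^-1` B'.
  by apply/seteqP; split=> o; rewrite /B' /= step_def.
apply: U_indep_past => //; rewrite -[X in measurable X]setTI.
apply: measurable_fun_ifT => //; exact: measurable_fun_ler.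
Qed.

(** The step [i.+1] costs [gamma p] and the jump an update at time [i], hence one
    more factor [p]: this is the weight [i^(- eta_gamma - 2 eta_p)]. *)
Let jump_series t x : Rs 0%N t ->
  (\sum_(1 <= i <oo)
    ('E_(law (Z t x))[step (Z t x) i.+1] * (xi i `^ alpha_w)%:E
     * 'E_(law (Z t x))[jump (t := t) (x := x) i]) < +oo)%E.
Proof.
move=> Rt.
pose K := c_gamma * c_p * c_p * (2 * d%:R * Cg * (c * V x) `^ beta_g).
apply: (series_lty _ _ sum1 (K := K)).
- by rewrite !mulr_ge0// ?powR_ge0// ltW.
- by move=> i; rewrite mulr_ge0// powR_ge0.
move=> i i1.
have E0 : (0 <= 'E_(law (Z t x))[jump (t := t) (x := x) i])%E.
  by apply: expectation_ge0 => o; exact: enorm_ge0.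
rewrite (expectation_step (@U_uniform t x Rt) (@step_def t x Rt) p01)//.
have [g0 gle] := gamma_S i1; have [p0 ple] := p_S i1.
rewrite -EFinM; split; first by rewrite mule_ge0// lee_fin !mulr_ge0// powR_ge0.
case: i i1 E0 g0 gle p0 ple => // i i1 E0 g0 gle p0 ple.
apply: (le_trans (lee_wpmul2l _ (jump_le x Rt i))).
  by rewrite lee_fin !mulr_ge0// powR_ge0.
rewrite -EFinM lee_fin; have [_ ->] := p_def i1.
set I := i.+1%:R; set X0 := xi i.+1.
have I0 : 0 < I by rewrite ltr0n.
rewrite powRM ?mulr_ge0 ?powR_ge0 ?(ltW c_gt0)//.
rewrite powRM ?powR_ge0 ?(ltW c_gt0)// -powRrM.
have -> : K * (I `^ (- eta_gamma - 2 * eta_p) * X0 `^ (alpha_w + S)) =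
    ((c_gamma * I `^ (- eta_gamma)) * (c_p * I `^ (- eta_p)))
    * (X0 `^ (alpha_w + S) * (c_p * I `^ (- eta_p)
       * (2 * d%:R * Cg * (c `^ beta_g * V x `^ beta_g)))).
  rewrite /K (powRM _ (ltW c_gt0) (V_ge0 x)).
  have -> : - eta_gamma - 2 * eta_p = - eta_gamma + (- eta_p + - eta_p) by ring.
  by rewrite (powRDpos (- eta_gamma) _ I0) (powRDpos (- eta_p) _ I0); ring.
have -> : gamma i.+2 * p i.+2 * X0 `^ alpha_w *
    (c_p * I `^ (- eta_p) * (2 * d%:R * Cg * X0 `^ alpha_g *
      (c `^ beta_g * X0 `^ (alpha_V * beta_g) * V x `^ beta_g)))
  = gamma i.+2 * p i.+2 * ((X0 `^ alpha_w * (X0 `^ alpha_g * X0 `^ (alpha_V * beta_g)))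
    * (c_p * I `^ (- eta_p) * (2 * d%:R * Cg * (c `^ beta_g * V x `^ beta_g)))).
  by ring.
have b0 : 0 <= c_p * I `^ (- eta_p) * (2 * d%:R * Cg * (c `^ beta_g * V x `^ beta_g)).
  by rewrite !mulr_ge0// ?powR_ge0// ltW.
apply: ler_pM; [exact: mulr_ge0| |exact: ler_pM|].
  by rewrite mulr_ge0// !mulr_ge0// powR_ge0.
rewrite ler_wpM2r// -!powRDpos ?xi_gt0// xi_le// lerD2l.
by rewrite [alpha_V * _]mulrC.
Qed.

Let sqr_series t x : Rs 0%N t ->
  (\sum_(1 <= i <oo)
    ('E_(law (Z t x))[fun o => (step (Z t x) i o ^+ 2)%R] *
     (xi i `^ (2 * alpha_w + 2 * Num.max (alpha_H + beta_H * alpha_V)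
                         (alpha_g + beta_g * alpha_V)))%:E) < +oo)%E.
Proof.
move=> Rt; apply: (series_lty _ _ sum2 (K := c_gamma ^+ 2 * c_p)).
- by rewrite mulr_ge0 ?sqr_ge0// ltW.
- by move=> i; rewrite mulr_ge0// powR_ge0.
move=> i i1.
rewrite (expectation_step_sqr (@U_uniform t x Rt) (@step_def t x Rt) p01)//.
have [/andP[/ltW g0 _] gE] := gamma_def i1; have [/andP[p0 _] pE] := p_def i1.
have I0 : 0 < i%:R :> R by rewrite ltr0n.
rewrite -EFinM !lee_fin; split; first by rewrite !mulr_ge0 ?exprn_ge0 ?powR_ge0.
have -> : c_gamma ^+ 2 * c_p
      * (i%:R `^ (- 2 * eta_gamma - eta_p) * xi i `^ (2 * (alpha_w + S)))
    = gamma i ^+ 2 * p i * xi i `^ (2 * (alpha_w + S)).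
  have -> : - 2 * eta_gamma - eta_p = - eta_gamma + - eta_gamma + - eta_p by ring.
  by rewrite gE pE !powRDpos//; ring.
rewrite ler_wpM2l ?mulr_ge0 ?exprn_ge0// xi_le//.
by rewrite mulrDr lerD2l ler_wpM2l// ge_max S_H S_g.
Qed.

Let mul_series t x : Rs 0%N t ->
  (\sum_(1 <= i <oo)
    ('E_(law (Z t x))[fun o => (step (Z t x) i.+1 o * step (Z t x) i o)%R] *
     (xi i `^ (alpha_H + alpha_g + (beta_H + beta_g) * alpha_V))%:E) < +oo)%E.
Proof.
move=> Rt; apply: (series_lty _ _ sum2 (K := c_gamma ^+ 2 * c_p)).
- by rewrite mulr_ge0 ?sqr_ge0// ltW.
- by move=> i; rewrite mulr_ge0// powR_ge0.
move=> i i1.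
rewrite (expectation_step_mul (U_indep x Rt) (@U_uniform t x Rt)
  (@step_def t x Rt) p01)//.
have [/andP[/ltW g0 _] gE] := gamma_def i1; have [/andP[p0 p1] pE] := p_def i1.
have [g0' gle] := gamma_S i1; have [p0' ple] := p_S i1.
have [/andP[_ p1'] _] := p_def (ltn0Sn i).
have I0 : 0 < i%:R :> R by rewrite ltr0n.
rewrite -EFinM !lee_fin; split; first by rewrite !mulr_ge0 ?powR_ge0.
have -> : c_gamma ^+ 2 * c_p
      * (i%:R `^ (- 2 * eta_gamma - eta_p) * xi i `^ (2 * (alpha_w + S)))
    = gamma i * gamma i * (1 * p i) * xi i `^ (2 * (alpha_w + S)).
  have -> : - 2 * eta_gamma - eta_p = - eta_gamma + - eta_gamma + - eta_p by ring.
  by rewrite gE pE !powRDpos//; ring.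
rewrite -gE in gle.
apply: ler_pM; rewrite ?powR_ge0// ?mulr_ge0//.
  by apply: ler_pM; rewrite ?mulr_ge0// ler_wpM2r.
rewrite xi_le// mulrDr.
have := lerD S_H S_g; have := alpha_w_gt0.
lra.
Qed.

(** The mean steps are proportional to [i^-a] with [a = eta_gamma + eta_p <= 1],
    so their differences are at most of order [i^(- a - 1)], and
    [eta_p <= 1] compares this with [i^(- eta_gamma - 2 eta_p)]. *)
Let sub_series t x : Rs 0%N t ->
  (\sum_(1 <= i <oo)
    (`| 'E_(law (Z t x))[fun o => (step (Z t x) i.+1 o - step (Z t x) i o)%R] | *
     (xi i `^ (alpha_w + alpha_g + beta_g * alpha_V))%:E) < +oo)%E.
Proof.
move=> Rt; apply: (series_lty _ _ sum1 (K := c_gamma * c_p)).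
- by rewrite mulr_ge0// ltW.
- by move=> i; rewrite mulr_ge0// powR_ge0.
move=> i i1.
rewrite (expectation_step_sub (@U_uniform t x Rt) (@step_def t x Rt) p01)//.
have [_ gE] := gamma_def i1; have [_ pE] := p_def i1.
have [_ gE'] := gamma_def (ltn0Sn i); have [_ pE'] := p_def (ltn0Sn i).
have I0 : 0 < i%:R :> R by rewrite ltr0n.
have I0' : 0 < i.+1%:R :> R by rewrite ltr0n.
rewrite abse_EFin -EFinM !lee_fin; split; first by rewrite mulr_ge0 ?powR_ge0.
set a := eta_gamma + eta_p.
have gpE (n : nat) : 0 < n%:R :> R ->
    c_gamma * n%:R `^ (- eta_gamma) * (c_p * n%:R `^ (- eta_p))
    = c_gamma * c_p * n%:R `^ (- a).
  by move=> n0; rewrite /a opprD powRDpos//; ring.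
rewrite gE pE gE' pE' !gpE// -mulrBr normrM ger0_norm; last first.
  by rewrite mulr_ge0 ?(ltW c_gamma_gt0) ?(ltW c_p_gt0).
rewrite -!mulrA (ler_wpM2l (ltW c_gamma_gt0))// (ler_wpM2l (ltW c_p_gt0))//.
have /andP[eg0 eg1] := eta_gamma01; have /andP[ep0 ep1] := eta_p01.
have a01 : 0 <= a <= 1 by rewrite /a eta_le1 addr_ge0// ltW.
apply: ler_pM; rewrite ?powR_ge0//.
  apply: (le_trans (powR_step_diff a01 i1)).
  by rewrite ler_powR ?ler1n// /a; lra.
by rewrite xi_le// -addrA lerD2l.
Qed.

Lemma condP_of_bounds : condP Theta P pi H Rs Z xi alpha_w.
Proof.
split=> //; exists g; split.
- by move=> t /gP[].
- by move=> t x Rt i; exact: indep_step.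
- move=> i i1; split=> t x t' x' Rt Rt'.
  + by rewrite !(expectation_step (@U_uniform _ _ _) (@step_def _ _ _) p01).
  + by rewrite !(expectation_step_sqr (@U_uniform _ _ _) (@step_def _ _ _) p01).
  + by rewrite !(expectation_step_mul (U_indep _ _) (@U_uniform _ _ _) (@step_def _ _ _) p01).
  + by rewrite !(expectation_step_sub (@U_uniform _ _ _) (@step_def _ _ _) p01).
exists V, (c + Cg), beta_H, beta_g, alpha_g, alpha_H, alpha_V; split=> //.
have cc : c <= c + Cg by rewrite lerDl.
have Cgc : Cg <= c + Cg by rewrite lerDr ltW.
move=> t x Rt; split.
- move=> i t' Rt'; apply: (le_trans (H_bound x Rt Rt')).
  by rewrite !ler_wpM2r// powR_ge0.
- move=> i; apply: (le_trans (V_bound x Rt i)).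
  by rewrite lee_fin !ler_wpM2r// powR_ge0.
- move=> i t' Rt'; apply: (le_trans (g_bound x Rt')).
  by rewrite !ler_wpM2r// powR_ge0.
- split; first by move=> i _; exact: measurable_jump.
  exact: jump_series.
- split; [exact: sqr_series|exact: mul_series|exact: sub_series].
Qed.

End verification.

(** * Choice of the exponents *)

Theorem proposition3p19 (R : realType) (d : nat) (dX : measure_display)
  (X : measurableType dX)
  (Theta : set 'rV[R]_d) (P : 'rV[R]_d -> R.-pker X ~> X)
  (pi : 'rV[R]_d -> probability X R) (H : 'rV[R]_d -> X -> 'rV[R]_d)
  (Rs : nat -> set 'rV[R]_d) (Z : 'rV[R]_d -> X -> sa_data R d X)
  (xi : nat -> R) (alpha_w : R)
  (U : forall t x, nat -> {mfun sa_space (Z t x) >-> R})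
  (gamma p : nat -> R) (c_gamma c_p eta_gamma eta_p : R)
  (V : X -> R) (c beta_H alpha_H alpha_V alpha_M alpha_rho : R)
  (P_measurable : forall B : set X, measurable B ->
     trace_measurable (Theta `*` [set: X]) (fun tx => P tx.1 tx.2 B))
  (H_measurable :
     trace_measurable (Theta `*` [set: X]) (fun tx => H tx.1 tx.2))
  (pi_invariant : forall t, Theta_hat Rs t -> invariant_prob (P t) (pi t) /\
     forall mu : probability X R, invariant_prob (P t) mu ->
       forall A, measurable A -> mu A = pi t A)
  (Rs0_nonempty : Rs 0%N !=set0)
  (Z_process : forall t x, Rs 0%N t -> sa_process_from P H Rs (Z t x) t x)
  (W : condW Theta pi H Rs Z xi alpha_w)
  (alpha_w_gt0 : 0 < alpha_w)
  (U_indep : forall t x, Rs 0%N t -> mutually_indep (law (Z t x)) (U t x))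
  (U_uniform : forall t x, Rs 0%N t -> forall i, (1 <= i)%N ->
     forall B : set R, measurable B ->
       distribution (law (Z t x)) (U t x i) B = uniform_prob (@ltr01 R) B)
  (U_indep_past : forall t x, Rs 0%N t -> forall i,
     indep_of (law (Z t x)) (filtX (Z t x) i) (U t x i.+1))
  (step_def : forall t x, Rs 0%N t -> forall i, (1 <= i)%N ->
     forall o, step (Z t x) i o = if U t x i o <= p i then gamma i else 0)
  (gamma_def : forall i, (1 <= i)%N ->
     0 < gamma i < 1 /\ gamma i = c_gamma * i%:R `^ (- eta_gamma))
  (p_def : forall i, (1 <= i)%N ->
     0 <= p i <= 1 /\ p i = c_p * i%:R `^ (- eta_p))
  (c_gamma_gt0 : 0 < c_gamma) (c_p_gt0 : 0 < c_p)
  (eta_gamma01 : 0 < eta_gamma < 1) (eta_p01 : 0 < eta_p < 1)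
  (eta_le1 : eta_gamma + eta_p <= 1)
  (eta_gt1 : 1 < 2 * eta_gamma + eta_p)
  (eta_gt1' : 1 < eta_gamma + 2 * eta_p)
  (V_measurable : measurable_fun [set: X] V) (V_ge1 : forall x, 1 <= V x)
  (beta_H_bounds : 0 <= beta_H <= 2^-1)
  (alpha_H_ge0 : 0 <= alpha_H) (alpha_V_ge0 : 0 <= alpha_V)
  (H_bound : forall t x, Rs 0%N t -> forall i t', Rs i t' ->
     enorm (H t' x) <= c * xi i `^ alpha_H * V x `^ beta_H)
  (V_bound : forall t x, Rs 0%N t -> forall i,
     ('E_(law (Z t x))[V \o state (Z t x) i]
      <= (c * xi i `^ alpha_V * V x)%:E)%E)
  (G : condG P pi Rs xi V alpha_M alpha_rho)
  (sum1 : (\sum_(1 <= i <oo)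
     (i%:R `^ (- eta_gamma - 2 * eta_p) *
      xi i `^ (alpha_w + alpha_M + alpha_rho + alpha_H
               + beta_H * alpha_V))%:E < +oo)%E)
  (sum2 : (\sum_(1 <= i <oo)
     (i%:R `^ (- 2 * eta_gamma - eta_p) *
      xi i `^ (2 * (alpha_w + alpha_H + alpha_M + alpha_rho
                    + beta_H * alpha_V)))%:E < +oo)%E) :
  condP Theta P pi H Rs Z xi alpha_w.
Proof.
have [t0 Rt0] := Rs0_nonempty.
have [aM0 ar0 _] := G.
have [w [M0 [cw [_ _ [RsS hatTheta] _ [_ aw0 _ [xi1 xiS] _]]]]] := W.
have p01 i : (1 <= i)%N -> 0 <= p i <= 1 by move=> /p_def[].
have xi0 i : 0 < xi i by exact: lt_le_trans ltr01 (xi1 i).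
have V0 x : 0 < V x by exact: lt_le_trans ltr01 (V_ge1 x).
have /andP[bH0 bH2] := beta_H_bounds.
have c0 : 0 <= c.
  have := le_trans (enorm_ge0 _) (H_bound t0 point Rt0 0%N t0 Rt0).
  by rewrite pmulr_lge0 ?powR_gt0// pmulr_lge0// powR_gt0.
have mH t : Theta_hat Rs t -> measurable_fun [set: X] (H t).
  move=> ht; apply: (trace_measurable_comp H_measurable (pair1_measurable t)).
  by move=> x; split=> //=; exact: hatTheta.
have HR i t x : Rs i t -> enorm (H t x) <= c * xi i `^ alpha_H * V x `^ beta_H.
  by move=> Rit; exact: (H_bound t0 x Rt0 i t Rit).
pose S := alpha_M + alpha_rho + alpha_H + beta_H * alpha_V.
have bHV0 : 0 <= beta_H * alpha_V by rewrite mulr_ge0.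
have sum1S : (\sum_(1 <= i <oo) (i%:R `^ (- eta_gamma - 2 * eta_p) *
    xi i `^ (alpha_w + S))%:E < +oo)%E by rewrite /S !addrA.
have sum2S : (\sum_(1 <= i <oo) (i%:R `^ (- 2 * eta_gamma - eta_p) *
    xi i `^ (2 * (alpha_w + S)))%:E < +oo)%E.
  have -> : alpha_w + S
      = alpha_w + alpha_H + alpha_M + alpha_rho + beta_H * alpha_V.
    by rewrite /S; ring.
  exact: sum2.
pose g t := poisson_sum (P t) (pi t) (H t).
have conclude (beta_g alpha_g alpha_V' c' Cg : R) :
    (forall t, Theta_hat Rs t -> poisson_solution P pi H t (g t) /\
      poisson_sum_cvg (P t) (pi t) (H t)) ->
    0 <= beta_g <= 2^-1 -> 0 <= alpha_g -> 0 <= alpha_V' <= alpha_V ->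
    0 <= c' -> 0 <= Cg ->
    (forall t x, Rs 0%N t -> forall i, ('E_(law (Z t x))[V \o state (Z t x) i]
      <= (c' * xi i `^ alpha_V' * V x)%:E)%E) ->
    (forall i t x, Rs i t ->
      enorm (g t x) + enorm (vintegral (P t x) (g t))
      <= Cg * xi i `^ alpha_g * V x `^ beta_g) ->
    alpha_g + beta_g * alpha_V' <= S ->
    condP Theta P pi H Rs Z xi alpha_w.
  move=> gP bg01 ag0 /andP[aV0 aVV] c'0 Cg0 Vb gb Sg.
  have cc : c <= c + c' + 1 by lra.
  have c'c : c' <= c + c' + 1 by lra.
  have cgt0 : 0 < c + c' + 1 by lra.
  have Hb t x : Rs 0%N t -> forall i t', Rs i t' ->
      enorm (H t' x) <= (c + c' + 1) * xi i `^ alpha_H * V x `^ beta_H.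
    move=> _ i t' Rt'; apply: (le_trans (HR i t' x Rt')).
    by rewrite !ler_wpM2r// powR_ge0.
  have Vb' t x : Rs 0%N t -> forall i,
      ('E_(law (Z t x))[V \o state (Z t x) i]
       <= ((c + c' + 1) * xi i `^ alpha_V' * V x)%:E)%E.
    move=> Rt i; apply: (le_trans (Vb t x Rt i)).
    by rewrite lee_fin !ler_wpM2r ?powR_ge0// ltW.
  have SH : alpha_H + beta_H * alpha_V' <= S.
    have : beta_H * alpha_V' <= beta_H * alpha_V by rewrite ler_wpM2l.
    by rewrite /S; lra.
  exact: (condP_of_bounds P_measurable H_measurable Z_process W alpha_w_gt0
    U_indep U_uniform U_indep_past step_def gamma_def p_def c_gamma_gt0
    c_p_gt0 eta_gamma01 eta_p01 eta_le1 V_measurable V_ge1 gP beta_H_bounds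
    bg01 ag0 alpha_H_ge0 aV0 cgt0 Cg0 Hb Vb' gb SH Sg sum1S sum2S).
(* Case beta_H > 0: (G) applies with r = beta_H and no interpolation. *)
have [bH_gt0|bH_le0] := ltP 0 beta_H.
  have r01 : 0 < beta_H <= 1 by rewrite bH_gt0; lra.
  have s01 : 0 < (1 : R) <= 1 by rewrite ltr01 lexx.
  have [gP [Cg Cg0 gb]] := ergodic_poisson V_measurable V_ge1 xi1 G mH c0 r01
    s01 HR (or_introl erefl).
  apply: (conclude _ _ alpha_V c Cg gP _ _ _ c0 Cg0 V_bound gb).
  - by rewrite mulr1.
  - by rewrite mul1r !addr_ge0.
  - by rewrite alpha_V_ge0 lexx.
  - by rewrite /S mul1r mulr1; lra.
have bH_eq0 : beta_H = 0 by apply/eqP; rewrite eq_le bH_le0.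
have HB i t x : Rs i t -> enorm (H t x) <= c * xi i `^ alpha_H.
  by move=> /HR -/(_ x); rewrite bH_eq0 powRr0 mulr1.
have r01 : 0 < (2^-1 : R) <= 1 by rewrite invr_gt0 ltr0n/= invf_le1 ?ler1n.
have HV i t x : Rs i t -> enorm (H t x) <= c * xi i `^ alpha_H * V x `^ 2^-1.
  move=> Rit; rewrite (le_trans (HB i t x Rit))// ler_peMr ?mulr_ge0 ?powR_ge0//.
  by rewrite powR_ge1// invr_ge0.
have SE : S = alpha_M + alpha_rho + alpha_H by rewrite /S bH_eq0 mul0r addr0.
(* Case beta_H = 0 < alpha_M: s is chosen so that the exponent of V, at most s,
   and the gain 1 - s on alpha_M balance: s (alpha_M + alpha_V) = alpha_M. *)
have [aM_gt0|aM_le0] := ltP 0 alpha_M.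
  pose s := alpha_M / (alpha_M + alpha_V).
  have aMV : 0 < alpha_M + alpha_V by rewrite ltr_wpDr.
  have s01 : 0 < s <= 1.
    by rewrite /s divr_gt0//= ler_pdivrMr// mul1r lerDl.
  have /andP[s0 s1] := s01.
  have sE : s * (alpha_M + alpha_V) = alpha_M by rewrite /s divfK// gt_eqF.
  have [gP [Cg Cg0 gb]] := ergodic_poisson V_measurable V_ge1 xi1 G mH c0 r01
    s01 HV (or_intror HB).
  apply: (conclude _ _ alpha_V c Cg gP _ _ _ c0 Cg0 V_bound gb).
  - by rewrite mulr_ge0 ?invr_ge0 ?(ltW s0)//= ler_piMr ?invr_ge0.
  - by rewrite !addr_ge0//; exact: mulr_ge0 (ltW s0) aM0.
  - by rewrite alpha_V_ge0 lexx.
  - have : 2^-1 * s * alpha_V <= s * alpha_V.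
      by rewrite ler_wpM2r// ler_piMl ?(ltW s0)//; lra.
    by rewrite SE; lra.
have aM_eq0 : alpha_M = 0 by apply/eqP; rewrite eq_le aM_le0.
have s01 : 0 < (1 : R) <= 1 by rewrite ltr01 lexx.
have [gP [Cg Cg0 gb]] := ergodic_poisson V_measurable V_ge1 xi1 G mH c0 r01
  s01 HV (or_introl erefl).
(* Case beta_H = alpha_M = 0: V has bounded moments, so alpha_V may be replaced
   by 0 and the exponent 1/2 of V in the bound on g costs nothing.  In dimension
   0, where ergodicity gives no information, g vanishes. *)
have [d0|d_gt0] := posnP d.
  apply: (conclude 0 0 alpha_V c 0 gP) => //.
  - by rewrite lexx; lra.
  - by rewrite alpha_V_ge0 lexx.
  - move=> i t x _; have n0 (v : 'rV[R]_d) : enorm v = 0.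
      rewrite /enorm big1 ?sqrtr0// => j.
      by exfalso; move: j; rewrite d0 => -[].
    by rewrite !n0 !mul0r addr0.
  - by rewrite mul0r addr0 SE !addr_ge0.
have G0 : condG P pi Rs xi V 0 alpha_rho by rewrite -aM_eq0.
have /andP[eg0 _] := eta_gamma01; have /andP[ep0 _] := eta_p01.
have eta0 : 0 <= eta_gamma + 2 * eta_p by lra.
have arS : alpha_rho <= alpha_w + S by rewrite SE; lra.
have [C C0 VC] := uniform_moment_condG P_measurable RsS hatTheta xi1 xiS
  Z_process U_uniform U_indep_past step_def p_def c_p_gt0
  eta0 eta_le1 V_measurable V_ge1 c0 alpha_V_ge0 V_bound G0 arS sum1S
  (Ordinal d_gt0).
apply: (conclude _ _ 0 C Cg gP _ _ _ C0 Cg0 _ gb).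
- by rewrite mulr1 invr_ge0 ler0n lexx.
- by rewrite !addr_ge0 ?mulr_ge0.
- by rewrite lexx.
- by move=> t x Rt i; rewrite powRr0 mulr1; exact: VC.
- by rewrite mulr0 SE; lra.
Qed.
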